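(* Let $n,p\ge 1$ be any integers, let $X\in\mathbb{R}^{n\times p}$ be any matrix, let $y\in\{0,1\}^n$, let $Q\in\mathbb{R}^{p\times p}$ be symmetric positive definite and let $v\in\mathbb{R}^p$. Then the Albert–Chib data augmentation (AC-DA) Markov chain $\Psi$ on $\mathbb{R}^p$ determined by $(X,y,Q,v)$ is geometrically ergodic: there exist a constant $\eta\in[0,1)$ and a function $C:\mathbb{R}^p\to[0,\infty)$ such that for every $\beta\in\mathbb{R}^p$ and every integer $m\ge1$, $$\sup_{A\in\mathcal{B}}\big|K^m(\beta,A)-\Pi(A\mid y)\big|\le C(\beta)\,\eta^m,$$ where $\mathcal{B}$ is the Borel $\sigma$-field of $\mathbb{R}^p$, $K^m$ is the $m$-step transition function of $\Psi$ and $\Pi(\cdot\mid y)$ is the posterior distribution of $\beta$.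
   Context: Setting (Bayesian probit regression with proper normal prior). $X$ is an $n\times p$ real matrix whose $i$th row is $x_i^T$, $x_i\in\mathbb{R}^p$; $y=(y_1,\dots,y_n)^T\in\{0,1\}^n$; $\Phi$ is the standard normal distribution function; the prior $\pi(\beta)$ on $\beta\in\mathbb{R}^p$ is the $N_p(Q^{-1}v,Q^{-1})$ density. The posterior density is $$\pi(\beta\mid y)=\frac{1}{m(y)}\,\pi(\beta)\prod_{i=1}^n[\Phi(x_i^T\beta)]^{y_i}[1-\Phi(x_i^T\beta)]^{1-y_i},$$ with $m(y)$ the normalizing constant, and $\Pi(A\mid y)=\int_A\pi(\beta\mid y)\,d\beta$. Let $\mathcal{Z}\subset\mathbb{R}^n$ be the Cartesian product of the $n$ half lines, the $i$th being $(0,\infty)$ if $y_i=1$ and $(-\infty,0]$ if $y_i=0$. Two conditional densities are used: - $\pi(\beta\mid z,y)$, for $z\in\mathcal{Z}$, is the density in $\beta$ of $N_p\big((X^TX+Q)^{-1}(v+X^Tz),\,(X^TX+Q)^{-1}\big)$. - $\pi(z\mid\beta,y)$, for $\beta\in\mathbb{R}^p$, is the density on $\mathcal{Z}$ under which $z_1,\dots,z_n$ are independent and $z_i$ has the $N(x_i^T\beta,1)$ distribution truncated to $(0,\infty)$ if $y_i=1$ and to $(-\infty,0]$ if $y_i=0$. The AC-DA Markov chain $\Psi=(\beta_m)_{m\ge0}$ moves from current state $\beta'$ by drawing $z\sim\pi(\cdot\mid\beta',y)$ and then the new state $\beta\sim\pi(\cdot\mid z,y)$; its transition density is $k(\beta',\beta)=\int_{\mathcal{Z}}\pi(\beta\mid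 z,y)\,\pi(z\mid\beta',y)\,dz$. Its transition function is $K(\beta',A)=\int_Ak(\beta',\beta)\,d\beta$, and $K^1=K$, $K^m(\beta',A)=\int_{\mathbb{R}^p}K^{m-1}(\beta,A)\,K(\beta',d\beta)$ for $m\ge2$. *)

(* Defs.v *)
From HB Require Import structures.
From mathcomp Require Import all_boot all_order all_algebra.
From mathcomp Require Import all_classical all_reals all_analysis.
From mathcomp Require Import measurable_realfun.
Set Implicit Arguments.
Unset Strict Implicit.
Unset Printing Implicit Defensive.
Import Order.TTheory GRing.Theory Num.Theory.
Import numFieldNormedType.Exports.
Local Open Scope classical_set_scope.
Local Open Scope ring_scope.

(* Matrices carry the Borel sigma-algebra of their (product) topology. *)
Section borel_matrix.
Context (R : realType) (m n : nat).

HB.instance Definition _ := @isMeasurable.Build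
  (sigma_display (@open 'M[R]_(m, n))) 'M[R]_(m, n) <<s (@open 'M[R]_(m, n)) >>
  (@sigma_algebra0 _ setT _) (@sigma_algebraC _ _)
  (@sigma_algebra_bigcup _ setT _).

Lemma open_measurable_mx (U : set 'M[R]_(m, n)) : open U -> measurable U.
Proof. exact: sub_sigma_algebra. Qed.

Lemma open_bigcup_ball (U : set 'M[R]_(m, n)) : open U ->
  U = \bigcup_(k in [set k : 'M[rat]_(m, n) * nat |
        ball (map_mx ratr k.1 : 'M[R]_(m, n)) k.2.+1%:R^-1 `<=` U])
      ball (map_mx ratr k.1 : 'M[R]_(m, n)) k.2.+1%:R^-1.
Proof.
move=> oU; apply/seteqP; split=> [M UM|M [k /= kU]]; last exact: kU.
have /nbhs_ballP[e /= e0 eU] : nbhs M U by exact: open_nbhs_nbhs.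
have [k ke] : exists k, k.+1%:R^-1 < e / 2.
  have [N _ HN] := near_infty_natSinv_lt (PosNum (divr_gt0 e0 (ltr0Sn R 1))).
  by exists N; apply: HN => /=.
have k0 : 0 < k.+1%:R^-1 :> R by rewrite invr_gt0.
have qP i j : exists q : rat, ball (M i j) k.+1%:R^-1 (ratr q : R).
  have [x [Bx [q _ qx]]] := @dense_rat R (ball (M i j) k.+1%:R^-1)
    (ex_intro _ _ (ballxx (M i j) k0)) (ball_open _ _).
  by exists q; rewrite qx.
pose Mq : 'M[rat]_(m, n) := \matrix_(i, j) sval (cid (qP i j)).
have MMq : ball (map_mx ratr Mq : 'M[R]_(m, n)) k.+1%:R^-1 M.
  apply: ball_sym; split=> // i j; rewrite !mxE.
  exact: (svalP (cid (qP i j))).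
exists (Mq, k) => //= N MqN; apply: eU.
apply: (@ball_splitr _ _ (map_mx ratr Mq : 'M[R]_(m, n))).
  exact: (le_ball (ltW ke) MMq).
exact: (le_ball (ltW ke) MqN).
Qed.

End borel_matrix.

Section borel_matrix_fun.
Context d (T : measurableType d) (R : realType) (m n : nat).

Lemma measurable_fun_openP (f : T -> 'M[R]_(m, n)) :
  (forall U, open U -> measurable (f @^-1` U)) -> measurable_fun setT f.
Proof.
move=> mf; apply: (@measurability _ _ _ _ _ _ (@open 'M[R]_(m, n))) => //.
by move=> _ [U oU <-]; rewrite setTI; exact: mf.
Qed.

Lemma measurable_fun_coordP (f : T -> 'M[R]_(m, n)) :
  (forall i j, measurable_fun setT (fun x => f x i j)) -> measurable_fun setT f.
Proof.
move=> mf; apply: measurable_fun_openP => U /open_bigcup_ball ->.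
rewrite preimage_bigcup bigcup_mkcond.
apply: countable_bigcupT_measurable => [|[Mq k]]; first exact: countableP.
case: ifP => _ //.
set M := map_mx _ _; set e := _^-1.
have -> : f @^-1` ball M e = \bigcap_(ij : 'I_m * 'I_n)
    ((fun x => f x ij.1 ij.2) @^-1` ball (M ij.1 ij.2) e).
  apply/seteqP; split=> x.
    by move=> [_ Bx] [i j] _; exact: Bx.
  move=> Bx; split; first by rewrite invr_gt0.
  by move=> i j; exact: (Bx (i, j)).
rewrite -[X in measurable X]setCK setC_bigcap; apply: measurableC.
apply: countable_bigcupT_measurable => [|[i j]]; first exact: countableP.
apply: measurableC; rewrite -[X in measurable X]setTI; apply: mf => //.
by apply: open_measurable; exact: ball_open.
Qed.

End borel_matrix_fun.

Lemma measurable_coord (R : realType) m n i j :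
  measurable_fun setT (fun M : 'M[R]_(m, n) => M i j).
Proof.
apply: (measurability (@RGenOpens.G R)).
  exact: RGenOpens.measurableE.
move=> _ [_ [x [y ->]] <-]; rewrite setTI; apply: open_measurable_mx.
move/continuousP: (@coord_continuous R m n i j); apply.
exact: interval_open.
Qed.

Section lebesgue_cv.
Context (R : realType).

Definition cons_cv n (x : R * 'cV[R]_n) : 'cV[R]_n.+1 :=
  col_mx (const_mx x.1 : 'cV_1) x.2.

Definition uncons_cv n (x : 'cV[R]_n.+1) : R * 'cV[R]_n :=
  (x ord0 ord0, dsubmx (x : 'cV_(1 + n))).

Lemma cons_cvK n : cancel (@cons_cv n) (@uncons_cv n).
Proof.
case=> a x; rewrite /uncons_cv /cons_cv col_mxKd; congr pair.
transitivity (col_mx (const_mx a : 'cV_1) x (lshift n ord0) ord0).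
  by congr (col_mx _ _ _ _); exact/val_inj.
by rewrite col_mxEu mxE.
Qed.

Lemma uncons_cvK n : cancel (@uncons_cv n) (@cons_cv n).
Proof.
move=> x; rewrite /cons_cv /uncons_cv /=.
have -> : const_mx (x ord0 ord0) = usubmx (x : 'cV_(1 + n)).
  by apply/colP => i; rewrite !mxE !ord1; congr (x _ _); exact/val_inj.
exact: (@vsubmxK _ 1 n 1).
Qed.

Lemma measurable_cons_cv n : measurable_fun setT (@cons_cv n).
Proof.
apply: measurable_fun_coordP => i j.
rewrite /cons_cv.
case: (@splitP 1 n i) => k ik.
  rewrite (_ : (fun x => _) = fst) ?measurable_fst//; last first.
  apply/funext => x; rewrite (_ : i = lshift n k); last exact/val_inj.
  by rewrite (@col_mxEu _ 1 n 1) mxE.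
rewrite (_ : (fun x => _) = (fun M : 'cV[R]_n => M k j) \o snd).
  by apply: measurableT_comp => //; exact: measurable_coord.
apply/funext => x /=; rewrite (_ : i = rshift 1 k); last exact/val_inj.
by rewrite (@col_mxEd _ 1 n 1).
Qed.

Lemma measurable_uncons_cv n : measurable_fun setT (@uncons_cv n).
Proof.
apply/measurable_fun_pairP; split; first exact: measurable_coord.
apply: measurable_fun_coordP => i j.
rewrite (_ : (fun x => _) = fun x : 'cV[R]_n.+1 => x (rshift 1 i) j).
  exact: measurable_coord.
by apply/funext => x /=; rewrite mxE.
Qed.

Section step.
Context (n : nat) (mu : {sigma_finite_measure set 'cV[R]_n -> \bar R}).

Definition lebesgue_cons : set 'cV[R]_n.+1 -> \bar R :=
  pushforward (lebesgue_measure \x mu)%E (@cons_cv n).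

Let mf := @measurable_cons_cv n.

Let lebesgue_cons0 : lebesgue_cons set0 = 0%E.
Proof. exact: measure0. Qed.

Let lebesgue_cons_ge0 A : (0 <= lebesgue_cons A)%E.
Proof. exact: measure_ge0. Qed.

Let lebesgue_cons_sigma_additive : semi_sigma_additive lebesgue_cons.
Proof. exact: measure_semi_sigma_additive. Qed.

HB.instance Definition _ := isMeasure.Build _ _ _ lebesgue_cons
  lebesgue_cons0 lebesgue_cons_ge0 lebesgue_cons_sigma_additive.

Let lebesgue_cons_sigma_finite : sigma_finite setT lebesgue_cons.
Proof.
have /sigma_finiteP[F [TF ndF Foo]] := sigma_finiteT (@lebesgue_measure R).
have /sigma_finiteP[G [TG ndG Goo]] := sigma_finiteT mu.
exists (fun k => @uncons_cv n @^-1` (F k `*` G k)).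
  apply/seteqP; split=> // x _.
  have [k _ Fk] : (\bigcup_k F k) (uncons_cv x).1 by rewrite -TF.
  have [l _ Gl] : (\bigcup_k G k) (uncons_cv x).2 by rewrite -TG.
  exists (maxn k l) => //; split.
    by move: Fk; exact/subsetPset/ndF/leq_maxl.
  by move: Gl; exact/subsetPset/ndG/leq_maxr.
move=> k; have [mF Fk] := Foo k; have [mG Gk] := Goo k; split.
  rewrite -[X in measurable X]setTI; apply: measurable_uncons_cv => //.
  exact: measurableX.
rewrite /lebesgue_cons /pushforward -comp_preimage.
rewrite (_ : _ \o _ = idfun); last by apply/funext; exact: cons_cvK.
by rewrite preimage_id product_measure1E// lte_mul_pinfty// ge0_fin_numE.
Qed.

HB.instance Definition _ := Measure_isSigmaFinite.Build _ _ _ lebesgue_cons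
  lebesgue_cons_sigma_finite.

End step.

(* Lebesgue measure on R^n as an n-fold product measure, transported to column
   vectors; see lebesgue_cv_box for its value on boxes. *)
Fixpoint lebesgue_cv n : {sigma_finite_measure set 'cV[R]_n -> \bar R} :=
  if n is n'.+1 then lebesgue_cons (lebesgue_cv n') else \d_(0 : 'cV[R]_0).

End lebesgue_cv.

Section lebesgue_cv_box.
Context (R : realType).

Lemma lebesgue_cv_box n (A : 'I_n -> set R) : (forall i, measurable (A i)) ->
  lebesgue_cv R n [set x | forall i, A i (x i ord0)] =
  (\prod_(i < n) lebesgue_measure (A i))%E.
Proof.
elim: n A => [|n IHn] A mA.
  by rewrite big_ord0 /= diracE mem_set//=; case.
rewrite big_ord_recl -(IHn (fun i => A (lift ord0 i)))//=.
have mA' : measurable [set x : 'cV[R]_n | forall i, A (lift ord0 i) (x i ord0)].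
  rewrite (_ : [set _ | _] = \bigcap_(i : 'I_n)
    ((fun x : 'cV[R]_n => x i ord0) @^-1` A (lift ord0 i))); last first.
    by apply/seteqP; split=> x /= Ax i; [move=> _|]; exact: Ax.
  rewrite -[X in measurable X]setCK setC_bigcap; apply: measurableC.
  apply: countable_bigcupT_measurable => [|i]; first exact: countableP.
  apply: measurableC; rewrite -[X in measurable X]setTI.
  exact: measurable_coord.
rewrite -[RHS](product_measure1E lebesgue_measure (lebesgue_cv R n))//.
rewrite /lebesgue_cons /pushforward; congr product_measure1.
apply/seteqP; split=> -[a x] /=.
  move=> Ax; split=> [|i].
    by have := Ax ord0; rewrite -[X in A _ X]/((uncons_cv _).1) cons_cvK.
  have := Ax (lift ord0 i).
  rewrite (_ : cons_cv _ _ _ = x i ord0)// /cons_cv.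
  rewrite (_ : lift ord0 i = rshift 1 i) ?(@col_mxEd _ 1 n 1)//.
  exact/val_inj.
move=> [Aa Ax] i; case: (unliftP ord0 i) => [j ->|->].
  rewrite (_ : cons_cv _ _ _ = x j ord0)// /cons_cv.
  rewrite (_ : lift ord0 j = rshift 1 j) ?(@col_mxEd _ 1 n 1)//.
  exact/val_inj.
  by rewrite -[X in A _ X]/((uncons_cv _).1) cons_cvK.
exact: (mA ord0).
Qed.

End lebesgue_cv_box.

Section transition_functions.
Context d (T : measurableType d) (R : realType).

(* The m-step transition function K^m, with K^0 the identity kernel.  K is a
   plain function so that it can be defined by an integral formula; only the
   values of K x on measurable sets contribute to the integral against K x of
   a measurable function. *)
Fixpoint iter_kernel (K : T -> set T -> \bar R) (m : nat) (x : T) (A : set T) :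
    \bar R :=
  match m with
  | 0 => \d_x A
  | 1 => K x A
  | m'.+1 => (\int[K x]_z iter_kernel K m' z A)%E
  end.

End transition_functions.

Section normal_densities.
Context (R : realType).

Definition sym_posdef p (Q : 'M[R]_p) : Prop :=
  Q^T = Q /\ forall u : 'cV[R]_p, u != 0 -> 0 < (u^T *m Q *m u) ord0 ord0.

(* Density of N_p(mu, Sigma); Sigma is the covariance matrix. *)
Definition mvnormal_pdf p (mu : 'cV[R]_p) (Sigma : 'M[R]_p) (x : 'cV[R]_p) : R :=
  (Num.sqrt ((2 * pi) ^+ p * \det Sigma))^-1 *
  expR (- ((x - mu)^T *m invmx Sigma *m (x - mu)) ord0 ord0 / 2).

Definition std_normal_cdf (t : R) : R := fine (normal_prob 0 1 `]-oo, t]%classic).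

(* Density of N(mu, 1) conditioned on B; the second parameter of normal_pdf and
   normal_prob is the standard deviation. *)
Definition truncated_normal_pdf (mu : R) (B : set R) (t : R) : R :=
  normal_pdf mu 1 t * \1_B t / fine (normal_prob mu 1 B).

End normal_densities.

Section albert_chib.
Context (R : realType) (n p : nat).
Context (X : 'M[R]_(n, p)) (y : 'I_n -> bool) (Q : 'M[R]_p) (v : 'cV[R]_p).
Implicit Types (beta : 'cV[R]_p) (z : 'cV[R]_n).

(* The i-th row of X is the transpose of x_i, so (X *m beta) i ord0 is the inner
   product of x_i and beta; y i : bool is coerced to 0 or 1 in exponents. *)

Definition prior_pdf beta : R := mvnormal_pdf (invmx Q *m v) (invmx Q) beta.

Definition probit_likelihood beta : R :=
  \prod_(i < n) (std_normal_cdf ((X *m beta) i ord0) ^+ y i *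
                 (1 - std_normal_cdf ((X *m beta) i ord0)) ^+ (1 - y i)).

Definition marginal_likelihood : \bar R :=
  (\int[lebesgue_cv R p]_beta (prior_pdf beta * probit_likelihood beta)%:E)%E.

Definition posterior_pdf beta : R :=
  (fine marginal_likelihood)^-1 * (prior_pdf beta * probit_likelihood beta).

Definition posterior (A : set 'cV[R]_p) : \bar R :=
  (\int[lebesgue_cv R p]_(beta in A) (posterior_pdf beta)%:E)%E.

Definition half_line (b : bool) : set R :=
  if b then `]0, +oo[%classic else `]-oo, 0]%classic.

Definition latent_space : set 'cV[R]_n :=
  [set z | forall i, half_line (y i) (z i ord0)].

Definition beta_given_z_pdf z beta : R :=
  mvnormal_pdf (invmx (X^T *m X + Q) *m (v + X^T *m z))
               (invmx (X^T *m X + Q)) beta.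

Definition z_given_beta_pdf beta z : R :=
  \prod_(i < n) truncated_normal_pdf ((X *m beta) i ord0) (half_line (y i))
                                     (z i ord0).

Definition acda_density beta' beta : \bar R :=
  (\int[lebesgue_cv R n]_(z in latent_space)
     (beta_given_z_pdf z beta * z_given_beta_pdf beta' z)%:E)%E.

Definition acda_kernel beta' (A : set 'cV[R]_p) : \bar R :=
  (\int[lebesgue_cv R p]_(beta in A) acda_density beta' beta)%E.

End albert_chib.

(* Main.v *)
Require Import Defs.
From HB Require Import structures.
From mathcomp Require Import all_boot all_order all_algebra.
From mathcomp Require Import all_classical all_reals all_analysis.
From mathcomp Require Import measurable_realfun ring lra.
Set Implicit Arguments.
Unset Strict Implicit.
Unset Printing Implicit Defensive.
Import Order.TTheory GRing.Theory Num.Theory.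
Import numFieldNormedType.Exports.
Local Open Scope classical_set_scope.
Local Open Scope ring_scope.

(** The chain contracts in Wasserstein distance for the norm
    [N u = sqrt (u^T M u)], [M = X^T X + Q], and its last Gaussian draw turns
    this into a bound in total variation.

    Given the latent vector [z], the new state is [M^-1 (v + X^T z)] plus a
    noise independent of [z].  Two unit-variance normal laws with means [mu]
    and [mu'], truncated to the same half line and coupled through their
    quantile functions, stay within [|mu - mu'|] of each other, by the monotone
    likelihood ratio property in one direction and by a shift in the other.
    So the chains started at [beta] and [beta'] admit latent vectors with
    [|z - z'| <= |X (beta - beta')|] in each coordinate, and since
    [|X u|^2 <= rho (N u)^2] for some [rho < 1] this gives
    [N (M^-1 X^T (z - z')) <= rho N (beta - beta')].  Hence a step maps
    [c]-Lipschitz functions to [rho c]-Lipschitz functions.  Two Gaussian laws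
    with covariance [M^-1] differ in total variation by at most [N] of the
    difference of their means, so [K(., A)] is [rho]-Lipschitz and [K^m(., A)]
    is [rho^m]-Lipschitz.  Integrating over the invariant posterior, which has
    a finite first moment, gives the theorem with
    [C beta = int N (beta - b) Pi(db | y)].  *)

(** * Bilinear forms *)

Section bilinear.
Context (R : realType).

(** The norm serves twice. As [M] is the precision of the Gaussian draw, [N] measures how far apart
    two shifted draws are; and for the inner product of [M], the map [M^-1 X^T] is the adjoint of
    [X]. Both maps have norm at most [sqrt rho], which is why their composition, with the
    coordinatewise comparison of latent vectors in between, gains a full factor [rho]. The value
    [rho = k / (1 + k)] comes from [X^T X <= k Q].

    No coupling is built as a measure on pairs. A Lipschitz property is a one-sided inequality
    [f x <= f x' + c] for nonnegative extended real functions, required for all pairs of points, and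
    a coupling is an inequality between two integrals. In this form Tonelli's theorem and
    monotonicity of the integral carry the argument, no integrability of test functions has to be
    tracked, and the coupling of product laws follows by induction on the dimension. Subtraction of
    values of the iterates waits until the final estimate, where they are known to be at most
    one. *)

Definition bil p (P : 'M[R]_p) (u w : 'cV[R]_p) : R :=
  (u^T *m P *m w) ord0 ord0.

Definition sqform p (P : 'M[R]_p) (u : 'cV[R]_p) : R := bil P u u.

Section bil_theory.
Context (p : nat).
Implicit Types (P : 'M[R]_p) (u w : 'cV[R]_p) (a : R).

Lemma bilDl P u u' w : bil P (u + u') w = bil P u w + bil P u' w.
Proof. by rewrite /bil linearD/= !mulmxDl mxE. Qed.

Lemma bilDr P u w w' : bil P u (w + w') = bil P u w + bil P u w'.
Proof. by rewrite /bil mulmxDr mxE. Qed.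

Lemma bilZl P a u w : bil P (a *: u) w = a * bil P u w.
Proof. by rewrite /bil linearZ/= -!scalemxAl mxE. Qed.

Lemma bilZr P a u w : bil P u (a *: w) = a * bil P u w.
Proof. by rewrite /bil -scalemxAr mxE. Qed.

Lemma bilNl P u w : bil P (- u) w = - bil P u w.
Proof. by rewrite -scaleN1r bilZl mulN1r. Qed.

Lemma bilNr P u w : bil P u (- w) = - bil P u w.
Proof. by rewrite -scaleN1r bilZr mulN1r. Qed.

Lemma bil_tr P u w : bil P^T u w = bil P w u.
Proof.
rewrite /bil; have -> : u^T *m P^T *m w = (w^T *m P *m u)^T.
  by rewrite !trmx_mul trmxK mulmxA.
by rewrite mxE.
Qed.

Lemma bilC P u w : P^T = P -> bil P u w = bil P w u.
Proof. by move=> {1}<-; exact: bil_tr. Qed.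

Lemma sqformN P u : sqform P (- u) = sqform P u.
Proof. by rewrite /sqform bilNl bilNr opprK. Qed.

Lemma sqform0 P : sqform P 0 = 0.
Proof. by rewrite /sqform /bil mulmx0 mxE. Qed.

Lemma sqformD P P' u : sqform (P + P') u = sqform P u + sqform P' u.
Proof. by rewrite /sqform /bil mulmxDr mulmxDl mxE. Qed.

Lemma sqformZ a P u : sqform (a *: P) u = a * sqform P u.
Proof. by rewrite /sqform /bil -scalemxAr -scalemxAl mxE. Qed.

Lemma sqform_posdef_gt0 P u : sym_posdef P -> u != 0 -> 0 < sqform P u.
Proof. by move=> [_ +]; exact. Qed.

Lemma sqform_posdef_ge0 P u : sym_posdef P -> 0 <= sqform P u.
Proof.
have [->|u0] := eqVneq u 0; first by rewrite sqform0.
by move=> /sqform_posdef_gt0 /(_ u0)/ltW.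
Qed.

Lemma sqformB P u w : P^T = P ->
  sqform P (u - w) = sqform P u - 2 * bil P u w + sqform P w.
Proof.
move=> sP; rewrite /sqform !(bilDl, bilDr, bilNl, bilNr) (bilC w u sP); lra.
Qed.

(** Parallelogram law: the difference of the two sides is [sqform P (u + w)]. *)
Lemma sqformB_le P u w : sym_posdef P ->
  sqform P (u - w) <= 2 * sqform P u + 2 * sqform P w.
Proof.
move=> dP; have := sqform_posdef_ge0 (u + w) dP; have [sP _] := dP.
rewrite -[w in u + w]opprK !sqformB// sqformN bilNr; lra.
Qed.

Lemma bil_cauchy_schwarz P u w : sym_posdef P ->
  bil P u w ^+ 2 <= sqform P u * sqform P w.
Proof.
move=> dP; have [sP _] := dP; have [->|w0] := eqVneq w 0.
  by rewrite sqform0 mulr0 /bil mulmx0 mxE expr0n.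
have qw := sqform_posdef_gt0 dP w0.
(* This vector is [sqform P w] times the component of [u] that is [P]-orthogonal to [w]; the scaling
   avoids a division. *)
have := sqform_posdef_ge0 (sqform P w *: u - bil P u w *: w) dP.
rewrite sqformB// /sqform !bilZl !bilZr -/(sqform P u) -/(sqform P w).
set b := bil P u w; set q := sqform P w; set r := sqform P u => h.
have : 0 <= q * (r * q - b ^+ 2) by apply: le_trans h _; rewrite le_eqVlt; apply/orP; left; apply/eqP; ring.
by rewrite pmulr_rge0// subr_ge0.
Qed.

Lemma posdef_unitmx P : sym_posdef P -> P \in unitmx.
Proof.
move=> [sP dP]; rewrite -row_free_unit -kermx_eq0; apply/eqP/row_matrixP => i.
rewrite row0; apply/eqP; apply: contraT => k0.
have /dP : (row i (kermx P))^T != 0 by rewrite -trmx0 (inj_eq trmx_inj).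
by rewrite trmxK -row_mul mulmx_ker row0 mul0mx mxE ltxx.
Qed.

Lemma posdef_scale a P : 0 < a -> sym_posdef P -> sym_posdef (a *: P).
Proof.
move=> a0 dP; split; first by rewrite linearZ/= dP.1.
by move=> u u0; rewrite -/(bil _ u u) -/(sqform _ _) sqformZ mulr_gt0// sqform_posdef_gt0.
Qed.

End bil_theory.

Definition dotcv n (u w : 'cV[R]_n) : R := \sum_i u i ord0 * w i ord0.

Lemma dotcvE n (u w : 'cV[R]_n) : dotcv u w = (u^T *m w) ord0 ord0.
Proof. by rewrite mxE; apply: eq_bigr => i _; rewrite mxE. Qed.

Lemma dotcv_ge0 n (u : 'cV[R]_n) : 0 <= dotcv u u.
Proof. by apply: sumr_ge0 => i _; rewrite -expr2 sqr_ge0. Qed.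

Lemma sqform_gram n p (X : 'M[R]_(n, p)) u :
  sqform (X^T *m X) u = dotcv (X *m u) (X *m u).
Proof. by rewrite dotcvE /sqform /bil trmx_mul !mulmxA. Qed.

Lemma posdef_gramD n p (X : 'M[R]_(n, p)) Q : sym_posdef Q ->
  sym_posdef (X^T *m X + Q).
Proof.
move=> dQ; split; first by rewrite linearD/= trmx_mul trmxK dQ.1.
move=> u u0; rewrite -/(bil _ u u) -/(sqform _ _) sqformD sqform_gram.
by rewrite ltr_wpDl ?dotcv_ge0// sqform_posdef_gt0.
Qed.

(* Each coordinate of [X u] is the [Q]-inner product of [u] with a fixed
   vector, so Cauchy-Schwarz replaces a compactness argument here. *)
Lemma gram_le_posdef n p (X : 'M[R]_(n, p)) Q : sym_posdef Q ->
  exists2 k, 0 <= k & forall u, sqform (X^T *m X) u <= k * sqform Q u.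
Proof.
move=> dQ; pose e i : 'cV[R]_p := invmx Q *m (row i X)^T.
exists (\sum_i sqform Q (e i)).
  by apply: sumr_ge0 => i _; exact: sqform_posdef_ge0.
move=> u; rewrite sqform_gram /dotcv mulr_suml; apply: ler_sum => i _.
rewrite -expr2 (_ : (X *m u) i ord0 = bil Q (e i) u).
  exact: bil_cauchy_schwarz.
rewrite /bil /e trmx_mul trmxK trmx_inv dQ.1 mulmxKV ?posdef_unitmx//.
by rewrite -row_mul [RHS]mxE.
Qed.

(** From [X^T X <= k Q] follows [(1 + k) X^T X <= k (X^T X + Q)], and [k / (1 + k) < 1]. The strict
    contraction of the chain originates here. *)
Lemma gram_contraction n p (X : 'M[R]_(n, p)) Q : sym_posdef Q ->
  exists rho, [/\ 0 <= rho, rho < 1 &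
    forall u, dotcv (X *m u) (X *m u) <= rho * sqform (X^T *m X + Q) u].
Proof.
move=> dQ; have [k k0 hk] := gram_le_posdef X dQ.
have k1 : 0 < 1 + k by lra.
exists (k / (1 + k)); split.
- by rewrite divr_ge0// ltW.
- by rewrite ltr_pdivrMr//; lra.
- move=> u; rewrite -sqform_gram sqformD mulrAC ler_pdivlMr//.
  by have := hk u; set a := sqform _ u; set b := sqform Q u; nra.
Qed.

(** Young's inequality. The free weight lets [gain_contraction] balance its two terms without square
    roots. *)
Lemma dotcv_am_gm n (u w : 'cV[R]_n) a : 0 < a ->
  2 * dotcv u w <= a * dotcv u u + a^-1 * dotcv w w.
Proof.
move=> a0; rewrite /dotcv !mulr_sumr -big_split/=; apply: ler_sum => i _.
set x := u i ord0; set y := w i ord0; rewrite -subr_ge0.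
rewrite (_ : _ - _ = a * (x - a^-1 * y) ^+ 2); last by field; rewrite gt_eqF.
by rewrite mulr_ge0 ?sqr_ge0// ltW.
Qed.

(* The conditional mean of beta depends on the latent vector through
   [M^-1 X^T z] with [M = X^T X + Q]. *)
Lemma gain_contraction n p (X : 'M[R]_(n, p)) Q rho (u : 'cV[R]_p)
    (w : 'cV[R]_n) : sym_posdef Q -> 0 <= rho ->
  (forall u, dotcv (X *m u) (X *m u) <= rho * sqform (X^T *m X + Q) u) ->
  dotcv w w <= dotcv (X *m u) (X *m u) ->
  sqform (X^T *m X + Q) (invmx (X^T *m X + Q) *m X^T *m w) <=
    rho ^+ 2 * sqform (X^T *m X + Q) u.
Proof.
move=> dQ rho0 hrho wu; have dM := posdef_gramD X dQ; set M := X^T *m X + Q in hrho dM *.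
set s := invmx M *m X^T *m w.
(* Adjointness: [M s = X^T w], hence the squared norm of [s] is the product of [X s] with [w]. *)
have sE : sqform M s = dotcv (X *m s) w.
  rewrite dotcvE /sqform /bil {2}/s -!mulmxA mulKVmx ?posdef_unitmx//.
  by rewrite (trmx_mul X s) mulmxA.
(* [rho] is inverted below. If it vanishes, then [X u] has length zero and so has [w]. *)
have [r0|r0] := eqVneq rho 0.
  move: (hrho u); rewrite r0 mul0r => h.
  have w0 : w = 0.
    have : dotcv w w <= 0 by lra.
    rewrite le_eqVlt ltNge dotcv_ge0 orbF psumr_eq0; last by move=> i _; rewrite -expr2 sqr_ge0.
    move=> /allP w0; apply/colP => i; rewrite mxE.
    by apply/eqP; have := w0 i; rewrite mem_index_enum mulf_eq0 orbb => /(_ isT).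
  by rewrite expr0n mul0r /s w0 mulmx0 sqform0.
have r1 : 0 < rho by rewrite lt_neqAle eq_sym r0.
have r2 : 0 < rho^-1 by rewrite invr_gt0.
(* The weight [rho^-1] gives [2 |s|^2 <= rho^-1 |X s|^2 + rho |w|^2 <= |s|^2 + rho^2 |u|^2], where
   [s] and [u] are measured in the norm of [M]. *)
have h1 := dotcv_am_gm (X *m s) w r2.
have h2 := hrho s; have h3 := hrho u.
rewrite invrK in h1; rewrite -sE in h1.
have h4 : rho^-1 * dotcv (X *m s) (X *m s) <= sqform M s by rewrite mulrC ler_pdivrMr// mulrC.
have h5 : rho * dotcv w w <= rho ^+ 2 * sqform M u.
  by rewrite expr2 -mulrA ler_wpM2l//; lra.
lra.
Qed.

End bilinear.

(** * Lebesgue measure on column vectors *)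

Section measurable_mx.
Context d (T : measurableType d) (R : realType).

Lemma measurable_fun_entry m n (f : T -> 'M[R]_(m, n)) i j :
  measurable_fun setT f -> measurable_fun setT (fun x => f x i j).
Proof. by move=> mf; exact: (measurableT_comp (measurable_coord i j) mf). Qed.

Lemma measurable_fun_mulmx m n p (f : T -> 'M[R]_(m, n)) (g : T -> 'M[R]_(n, p)) :
  measurable_fun setT f -> measurable_fun setT g ->
  measurable_fun setT (fun x => f x *m g x).
Proof.
move=> mf mg; apply: measurable_fun_coordP => i j.
under eq_fun do rewrite mxE.
apply: measurable_sum => k.
by apply: measurable_funM; exact: measurable_fun_entry.
Qed.

Lemma measurable_fun_addmx m n (f g : T -> 'M[R]_(m, n)) :
  measurable_fun setT f -> measurable_fun setT g ->
  measurable_fun setT (fun x => f x + g x).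
Proof.
move=> mf mg; apply: measurable_fun_coordP => i j.
under eq_fun do rewrite mxE.
by apply: measurable_funD; exact: measurable_fun_entry.
Qed.

Lemma measurable_fun_oppmx m n (f : T -> 'M[R]_(m, n)) :
  measurable_fun setT f -> measurable_fun setT (fun x => - f x).
Proof.
move=> mf; apply: measurable_fun_coordP => i j.
under eq_fun do rewrite mxE.
by apply: measurableT_comp => //; exact: measurable_fun_entry.
Qed.

Lemma measurable_fun_submx m n (f g : T -> 'M[R]_(m, n)) :
  measurable_fun setT f -> measurable_fun setT g ->
  measurable_fun setT (fun x => f x - g x).
Proof.
by move=> mf mg; apply: measurable_fun_addmx => //; exact: measurable_fun_oppmx.
Qed.

Lemma measurable_fun_trmx m n (f : T -> 'M[R]_(m, n)) :
  measurable_fun setT f -> measurable_fun setT (fun x => (f x)^T).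
Proof.
move=> mf; apply: measurable_fun_coordP => i j.
by under eq_fun do rewrite mxE; exact: measurable_fun_entry.
Qed.

Lemma measurable_fun_sqform p (P : 'M[R]_p) (f : T -> 'cV[R]_p) :
  measurable_fun setT f -> measurable_fun setT (fun x => sqform P (f x)).
Proof.
move=> mf; apply: measurable_fun_entry; apply: measurable_fun_mulmx => //.
apply: measurable_fun_mulmx => //; exact: measurable_fun_trmx.
Qed.

End measurable_mx.

Section integral_lebesgue_cv.
Context (R : realType).
Local Open Scope ereal_scope.

Lemma integral_cv0 (f : 'cV[R]_0 -> \bar R) : measurable_fun setT f ->
  \int[lebesgue_cv R 0]_x f x = f 0%R.
Proof. by move=> mf; rewrite integral_dirac// diracT mul1e. Qed.

Lemma measurable_cons_pair n (f : 'cV[R]_n.+1 -> \bar R) :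
  measurable_fun setT f -> measurable_fun setT (fun tx => f (cons_cv tx)).
Proof. by move=> mf; apply: measurableT_comp mf _; exact: measurable_cons_cv. Qed.

Lemma measurable_cons_r n (f : 'cV[R]_n.+1 -> \bar R) t :
  measurable_fun setT f -> measurable_fun setT (fun x => f (cons_cv (t, x))).
Proof.
by move=> /measurable_cons_pair mf; apply: measurableT_comp mf _; exact: measurable_pair1.
Qed.

Lemma integral_cv_consE n (f : 'cV[R]_n.+1 -> \bar R) :
  measurable_fun setT f -> (forall x, 0 <= f x) ->
  \int[lebesgue_cv R n.+1]_x f x =
  \int[(lebesgue_measure \x lebesgue_cv R n)]_tx f (cons_cv tx).
Proof.
move=> mf f0 /=; rewrite /lebesgue_cons ge0_integral_pushforward//=.
exact: measurable_cons_cv.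
Qed.

Lemma integral_cv_cons1 n (f : 'cV[R]_n.+1 -> \bar R) :
  measurable_fun setT f -> (forall x, 0 <= f x) ->
  \int[lebesgue_cv R n.+1]_x f x =
  \int[lebesgue_measure]_t \int[lebesgue_cv R n]_x f (cons_cv (t, x)).
Proof.
move=> mf f0; rewrite integral_cv_consE// fubini_tonelli1//.
exact: measurable_cons_pair.
Qed.

Lemma integral_cv_cons2 n (f : 'cV[R]_n.+1 -> \bar R) :
  measurable_fun setT f -> (forall x, 0 <= f x) ->
  \int[lebesgue_cv R n.+1]_x f x =
  \int[lebesgue_cv R n]_x \int[lebesgue_measure]_t f (cons_cv (t, x)).
Proof.
move=> mf f0; rewrite integral_cv_consE// fubini_tonelli2//.
exact: measurable_cons_pair.
Qed.

Lemma cons_cvD n (s t : R) (x y : 'cV[R]_n) :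
  cons_cv (s + t, x + y)%R = (cons_cv (s, x) + cons_cv (t, y))%R.
Proof.
rewrite /cons_cv (_ : const_mx _ = const_mx s + const_mx t)%R.
  exact/esym/(@add_col_mx _ 1 n 1).
by apply/matrixP => i j; rewrite !mxE.
Qed.

Lemma lebesgue_measure_translation (a : R) (A : set R) : measurable A ->
  pushforward lebesgue_measure ((fun x => x + a)%R : _ -> measurableTypeR R) A =
  lebesgue_measure A.
Proof.
move=> mA; have ma : measurable_fun setT (fun x : measurableTypeR R => (x + a)%R : measurableTypeR R).
  by apply: measurable_funD.
apply/esym/lebesgue_measure_unique => //= _ [[l r]] _ <-.
rewrite /pushforward (_ : _ @^-1` _ = `](l - a)%R, (r - a)%R]%classic).
  rewrite !lebesgue_measure_itv/= !lte_fin ltrD2r.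
  by case: ifPn => // _; rewrite -!EFinB; congr EFin; ring.
by apply/seteqP; split=> x /=; rewrite !in_itv/= ltrBlDr lerBrDr.
Qed.

Lemma integral_translation (f : R -> \bar R) (a : R) : measurable_fun setT f ->
  (forall x, 0 <= f x) ->
  \int[lebesgue_measure]_x f (x + a)%R = \int[lebesgue_measure]_x f x.
Proof.
move=> mf f0; have ma : measurable_fun setT (fun x : measurableTypeR R => (x + a)%R : measurableTypeR R).
  by apply: measurable_funD.
have := @ge0_integral_pushforward _ _ _ _ R _ ma lebesgue_measure setT f measurableT mf (fun y _ => f0 y).
rewrite preimage_setT => <-.
by apply: eq_measure_integral => A mA _; exact: lebesgue_measure_translation.
Qed.

(** Induction on the dimension, from translation invariance on the line. It lets a Gaussian draw be
    centred, so that draws with different means share their noise. *)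
Lemma integral_cv_translation n (f : 'cV[R]_n -> \bar R) (a : 'cV[R]_n) :
  measurable_fun setT f -> (forall x, 0 <= f x) ->
  \int[lebesgue_cv R n]_x f (x + a)%R = \int[lebesgue_cv R n]_x f x.
Proof.
have ma m (b : 'cV[R]_m) (g : 'cV[R]_m -> \bar R) :
    measurable_fun setT g -> measurable_fun setT (fun x : 'cV[R]_m => g (x + b)%R).
  by move=> mg; apply: measurableT_comp => //; exact: measurable_fun_addmx.
elim: n f a => [|n IH] f a mf f0.
  rewrite !integral_cv0//; last exact: ma.
  by congr f; apply/colP; case.
rewrite !integral_cv_cons1//; last exact: ma.
rewrite -[a](uncons_cvK); case: (uncons_cv a) => b w.
under eq_integral do under eq_integral do rewrite -cons_cvD.
under eq_integral => t _ do rewrite (IH (fun x => f (cons_cv ((t + b)%R, x))) w (measurable_cons_r _ mf))//.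
rewrite (integral_translation (f := fun t => \int[lebesgue_cv R n]_x f (cons_cv (t, x))))//.
  exact: (measurable_fun_fubini_tonelli_F (fun tx => f (cons_cv tx)) (measurable_cons_pair mf)).
by move=> t; exact: integral_ge0.
Qed.

End integral_lebesgue_cv.

(** * Gaussian integrals *)

Section gaussian_integral.
Context (R : realType).

(** Read off from the total mass of the normal law with standard deviation [a^(-1/2)]. *)
Lemma integral_gauss1 (a m : R) : 0 < a ->
  (\int[lebesgue_measure]_t (expR (- (a * (t - m) ^+ 2) / 2))%:E =
   (Num.sqrt (2 * pi / a))%:E)%E.
Proof.
move=> a0; pose s := (Num.sqrt a)^-1.
have sa : s ^+ 2 = a^-1 by rewrite exprVn sqr_sqrtr// ltW.
have s0 : s != 0 by rewrite invr_eq0 gt_eqF// sqrtr_gt0.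
have peakE : normal_peak s = (Num.sqrt (2 * pi / a))^-1.
  by rewrite /normal_peak sa; congr (Num.sqrt _)^-1; rewrite -mulr_natr; ring.
have w0 : 0 < Num.sqrt (2 * pi / a).
  by rewrite sqrtr_gt0 divr_gt0// mulr_gt0// pi_gt0.
have := integral_normal_pdf m s; rewrite normal_pdfE//.
under eq_integral do rewrite EFinM.
rewrite ge0_integralZl_EFin//=; last 3 first.
- by move=> x _; rewrite lee_fin normal_fun_ge0.
- by apply/measurable_EFinP; exact: measurable_normal_fun.
- exact: normal_peak_ge0.
rewrite peakE => /(congr1 (fun z => (Num.sqrt (2 * pi / a))%:E * z)%E).
rewrite mule1 muleA -EFinM divff ?gt_eqF// mul1e => <-.
apply: eq_integral => x _; rewrite /normal_fun sa; congr (expR _)%:E.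
by rewrite -mulr_natr; field; rewrite gt_eqF.
Qed.

Section schur.
Context (p : nat) (P : 'M[R]_(1 + p)).

(** Elimination of the first coordinate, in step with the recursive definition of [lebesgue_cv]
    through [cons_cv]: [schur_compl] is the Schur complement of the top left entry. *)
Definition schur_pivot : R := P ord0 ord0.
Definition schur_col : 'cV[R]_p := dlsubmx P.
Definition schur_compl : 'M[R]_p :=
  drsubmx P - schur_pivot^-1 *: (schur_col *m schur_col^T).

Hypothesis dP : sym_posdef P.

Let blockP : P = block_mx schur_pivot%:M schur_col^T schur_col (drsubmx P).
Proof.
rewrite -[LHS]submxK; congr block_mx; last first.
  by rewrite /schur_col trmx_dlsub dP.1.
apply/matrixP => i j; rewrite !mxE !ord1 eqxx mulr1n /schur_pivot.
by congr (P _ _); exact/val_inj.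
Qed.

Lemma sqform_cons (t : R) (w : 'cV[R]_p) :
  sqform P (cons_cv (t, w)) =
  schur_pivot * t ^+ 2 + 2 * t * dotcv schur_col w + sqform (drsubmx P) w.
Proof.
rewrite /sqform /bil {1}blockP /cons_cv /= tr_col_mx mul_row_block mul_row_col.
rewrite !mulmxDl !mxE !big_ord1 !mxE !big_ord1 !mxE eqxx mulr1n.
rewrite [X in _ + (X + _)](_ : _ = t * dotcv schur_col w); last first.
  rewrite /dotcv mulr_sumr; apply: eq_bigr => i _.
  by rewrite !mxE big_ord1 !mxE mulrA.
rewrite (_ : \sum_j w^T ord0 j * schur_col j ord0 = dotcv schur_col w); last first.
  by apply: eq_bigr => i _; rewrite mxE mulrC.
ring.
Qed.

Lemma schur_pivot_gt0 : 0 < schur_pivot.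
Proof.
have := sqform_cons 1 0; rewrite sqform0 /dotcv big1 => [|i _].
  rewrite expr1n !mulr1 mulr0 !addr0 => <-; apply: sqform_posdef_gt0 => //.
  apply/eqP => /colP/(_ ord0)/eqP; rewrite -[cons_cv _ _ _]/((uncons_cv _).1).
  by rewrite cons_cvK mxE/= oner_eq0.
by rewrite !mxE mulr0.
Qed.

(** Completion of the square in [t]: for fixed [w] the integral over [t] becomes a one-dimensional
    Gaussian one, and the Schur complement governs the rest. *)
Lemma sqform_schur (t : R) (w : 'cV[R]_p) :
  sqform P (cons_cv (t, w)) =
  schur_pivot * (t + dotcv schur_col w / schur_pivot) ^+ 2
  + sqform schur_compl w.
Proof.
have a0 := schur_pivot_gt0; rewrite sqform_cons /schur_compl.
rewrite -scaleNr sqformD sqformZ.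
rewrite (_ : sqform (schur_col *m _) w = dotcv schur_col w ^+ 2); last first.
  rewrite /sqform /bil mulmxA -mulmxA !mxE big_ord1 -dotcvE expr2; congr (_ * _).
    by apply: eq_bigr => i _; rewrite mulrC.
  by rewrite dotcvE.
have {a0} : schur_pivot != 0 by rewrite gt_eqF.
move: schur_pivot (dotcv _ _) (sqform _ _) => a d D a0.
by field.
Qed.

Lemma posdef_schur : sym_posdef schur_compl.
Proof.
split.
  rewrite /schur_compl linearB/= linearZ/= trmx_mul trmxK trmx_drsub.
  by rewrite dP.1.
move=> w w0; rewrite -/(bil _ w w) -/(sqform _ _).
(* This first coordinate minimizes the form for given [w]: the square vanishes and only the Schur
   complement is left. *)
have := sqform_schur (- (dotcv schur_col w / schur_pivot)) w.
rewrite addNr expr0n mulr0 add0r => <-; apply: sqform_posdef_gt0 => //.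
apply: contra w0 => /eqP e0; apply/eqP.
have -> : w = (uncons_cv (cons_cv (- (dotcv schur_col w / schur_pivot), w))).2.
  by rewrite cons_cvK.
by rewrite e0; apply/colP => i; rewrite !mxE.
Qed.

Lemma det_schur : \det P = schur_pivot * \det schur_compl.
Proof.
have a0 := schur_pivot_gt0.
have -> : P = block_mx 1%:M 0 (schur_pivot^-1 *: schur_col) 1%:M *m
    block_mx schur_pivot%:M schur_col^T 0 schur_compl.
  rewrite mulmx_block !mul1mx !mul0mx !addr0 /schur_compl.
  rewrite -!scalemxAl mul_mx_scalar scalerA mulVf ?gt_eqF// scale1r.
  by rewrite addrC subrK -blockP.
by rewrite det_mulmx det_lblock det_ublock !det1 !mul1r det_scalar1.
Qed.

End schur.

Lemma measurable_expR_sqform d (T : measurableType d) p (P : 'M[R]_p)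
    (f : T -> 'cV[R]_p) : measurable_fun setT f ->
  measurable_fun setT (fun x => expR (- sqform P (f x) / 2)).
Proof.
move=> mf; apply: measurableT_comp => //; apply: measurable_funM => //.
by apply: measurableT_comp => //; exact: measurable_fun_sqform.
Qed.

(** Positivity of the determinant is proved in the same induction: it follows from that of the pivot
    and of the smaller determinant, and the value of the integral divides by it. *)
Lemma posdef_det_integral_gauss p (P : 'M[R]_p) (m : 'cV[R]_p) : sym_posdef P ->
  0 < \det P /\
  (\int[lebesgue_cv R p]_x (expR (- sqform P (x - m) / 2))%:E =
   (Num.sqrt ((2 * pi) ^+ p / \det P))%:E)%E.
Proof.
elim: p P m => [|p IH] P m dP.
  rewrite det_mx00; split=> //; rewrite integral_cv0; last first.
    apply/measurable_EFinP; apply: measurable_expR_sqform.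
    exact: measurable_fun_submx.
  by rewrite (_ : _ - _ = 0) ?sqform0 ?oppr0 ?mul0r ?expR0 ?expr0 ?divr1 ?sqrtr1//; apply/colP; case.
have a0 := schur_pivot_gt0 dP; have dS := posdef_schur dP.
rewrite (det_schur dP); set a := schur_pivot P in a0 *.
set S := schur_compl P in dS *; set b := schur_col P.
have [S0 _] := IH S 0 dS; split; first exact: mulr_gt0.
(* The first coordinate is integrated innermost: with [x] fixed, the cross term only moves its
   mean. *)
rewrite integral_cv_cons2//; last first.
  apply/measurable_EFinP; apply: measurable_expR_sqform.
  exact: measurable_fun_submx.
rewrite -[m]uncons_cvK; case: (uncons_cv m) => m0 w0.
have cB t x : cons_cv (t, x) - cons_cv (m0, w0) = cons_cv (t - m0, x - w0).
  by have := cons_cvD (t - m0) m0 (x - w0) w0; rewrite !subrK => ->; rewrite addrK.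
under eq_integral => x _.
  under eq_integral => t _.
    rewrite cB (sqform_schur dP) -/a -/b -/S.
    rewrite (_ : - _ / 2 = - sqform S (x - w0) / 2 +
      (- (a * (t - (m0 - dotcv b (x - w0) / a)) ^+ 2) / 2)); last by ring.
    rewrite expRD EFinM; over.
  rewrite ge0_integralZl_EFin//; last first.
    apply/measurable_EFinP; apply: measurableT_comp => //.
    apply: measurable_funM => //; apply: measurableT_comp => //.
    apply: measurable_funM => //; apply: measurable_funX.
    exact: measurable_funB.
  rewrite integral_gauss1//; over.
rewrite /= ge0_integralZr//; last first.
  apply/measurable_EFinP; apply: measurable_expR_sqform.
  exact: measurable_fun_submx.
have [_ ->] := IH S w0 dS.
have pi2 : 0 < 2 * pi :> R by rewrite mulr_gt0// pi_gt0.
rewrite -EFinM -sqrtrM; last by rewrite divr_ge0 ?exprn_ge0// ltW.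
by congr (Num.sqrt _)%:E; rewrite exprS; field; rewrite !gt_eqF.
Qed.

End gaussian_integral.

(** * Multivariate normal densities and their total variation distance *)

Section mvnormal.
Context (R : realType).

(** [mvnormal_pdf] takes a covariance; here [P] is the precision, and covariances always have the
    form [invmx P]. *)
Definition gauss_cst p (P : 'M[R]_p) : R :=
  (Num.sqrt ((2 * pi) ^+ p * \det (invmx P)))^-1.

Section mvnormal_theory.
Context (p : nat) (P : 'M[R]_p).

Lemma mvnormal_pdfE (m x : 'cV[R]_p) :
  mvnormal_pdf m (invmx P) x = gauss_cst P * expR (- sqform P (x - m) / 2).
Proof. by rewrite /mvnormal_pdf invmxK. Qed.

Lemma measurable_mvnormal_pdf d (T : measurableType d) (f g : T -> 'cV[R]_p) :
  measurable_fun setT f -> measurable_fun setT g ->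
  measurable_fun setT (fun x => mvnormal_pdf (f x) (invmx P) (g x)).
Proof.
move=> mf mg; under eq_fun do rewrite mvnormal_pdfE.
apply: measurable_funM => //; apply: measurable_expR_sqform.
exact: measurable_fun_submx.
Qed.

Lemma mvnormal_pdf_ge0 (m x : 'cV[R]_p) : 0 <= mvnormal_pdf m (invmx P) x.
Proof. by rewrite mvnormal_pdfE mulr_ge0 ?expR_ge0// invr_ge0 sqrtr_ge0. Qed.

Hypothesis dP : sym_posdef P.

Lemma gauss_cst_gt0 : 0 < gauss_cst P.
Proof.
have [d0 _] := posdef_det_integral_gauss 0 dP.
rewrite invr_gt0 sqrtr_gt0 det_inv mulr_gt0 ?invr_gt0// exprn_gt0//.
by rewrite mulr_gt0// pi_gt0.
Qed.

Lemma integral_mvnormal_pdf (m : 'cV[R]_p) :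
  (\int[lebesgue_cv R p]_x (mvnormal_pdf m (invmx P) x)%:E = 1)%E.
Proof.
under eq_integral do rewrite mvnormal_pdfE EFinM.
rewrite ge0_integralZl_EFin//; last 2 first.
- apply/measurable_EFinP; apply: measurable_expR_sqform.
  exact: measurable_fun_submx.
- exact/ltW/gauss_cst_gt0.
have [d0 ->] := posdef_det_integral_gauss m dP.
rewrite -EFinM /gauss_cst det_inv mulVf// gt_eqF// sqrtr_gt0 divr_gt0//.
by rewrite exprn_gt0// mulr_gt0// pi_gt0.
Qed.

(** Parallelogram law about the midpoint. It makes the geometric mean of two normal densities equal
    to [expR (- D / 8)] times the normal density centred at the midpoint, with
    [D = sqform P (m - m')]. *)
Lemma sqform_midpoint (m m' x : 'cV[R]_p) :
  sqform P (x - m) + sqform P (x - m') =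
  2 * sqform P (x - 2^-1 *: (m + m')) + sqform P (m - m') / 2.
Proof.
pose u := x - 2^-1 *: (m + m'); pose w := 2^-1 *: (m - m').
have -> : x - m = u - w.
  by apply/colP => i; rewrite !mxE; field.
have -> : x - m' = u - - w.
  by apply/colP => i; rewrite !mxE; field.
have -> : m - m' = 2 *: w.
  by rewrite scalerA divff// scale1r.
rewrite -/u; move: u w => u w.
rewrite !sqformB ?dP.1// sqformN bilNr /sqform bilZl bilZr; lra.
Qed.

(* Hellinger-type bound: with [f = a^2] and [g = b^2] the two densities,
   [f - g <= (a - b)^2 / (2 c) + c (a^2 + b^2)], and the Hellinger affinity
   [int a b] is explicit. *)
Lemma mvnormal_tv_le (m m' : 'cV[R]_p) (A : set 'cV[R]_p) : measurable A ->
  (\int[lebesgue_cv R p]_(x in A) (mvnormal_pdf m (invmx P) x)%:E <=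
   \int[lebesgue_cv R p]_(x in A) (mvnormal_pdf m' (invmx P) x)%:E +
   (Num.sqrt (sqform P (m - m')))%:E)%E.
Proof.
move=> mA; have [->|mm'] := eqVneq m m'.
  by rewrite subrr sqform0 sqrtr0 adde0.
have mmd q0 : measurable_fun [set: 'cV[R]_p] (mvnormal_pdf q0 (invmx P)).
  by apply: measurable_mvnormal_pdf.
set D := sqform P (m - m'); have D0 : 0 < D.
  by apply: sqform_posdef_gt0 => //; rewrite subr_eq0.
set d := Num.sqrt D; have d0 : 0 < d by rewrite sqrtr_gt0.
have dD : D = d ^+ 2 by rewrite sqr_sqrtr// ltW.
(* The integral of [h] below is [(1 - rho) / c + 2 * c <= D / (8 * c) + 2 * c]; this [c] minimizes
   the bound, with value [d]. The case [m = m'], where [c] would be zero, is already settled. *)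
pose c := d / 4; have c0 : 0 < c by rewrite divr_gt0.
pose f x : R := mvnormal_pdf m (invmx P) x.
pose g x : R := mvnormal_pdf m' (invmx P) x.
(* The Hellinger affinity of the two laws, that is, the integral of [k]. *)
pose rho := expR (- D / 8).
pose k x : R := rho * mvnormal_pdf (2^-1 *: (m + m')) (invmx P) x.
have kE x : k x = Num.sqrt (f x) * Num.sqrt (g x).
  have G := ltW gauss_cst_gt0.
  rewrite /k /f /g !mvnormal_pdfE -sqrtrM; last by rewrite mulr_ge0 ?expR_ge0.
  rewrite mulrACA -expRD.
  set e := - D / 8 + - sqform P (x - 2^-1 *: (m + m')) / 2.
  rewrite (_ : - _ / 2 + - _ / 2 = e + e).
    rewrite expRD mulrACA -expr2 sqrtr_sqr ger0_norm ?mulr_ge0 ?expR_ge0//.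
    by rewrite expRD mulrCA.
  rewrite -mulrDl -opprD sqform_midpoint -/D /e.
  by set z := sqform P _; field.
pose h x : R := (2 * c)^-1 * (f x + g x - 2 * k x) + c * (f x + g x).
have f0 x : 0 <= f x by exact: mvnormal_pdf_ge0.
have g0 x : 0 <= g x by exact: mvnormal_pdf_ge0.
have k0 x : 0 <= k x by rewrite kE mulr_ge0.
have h0 x : 0 <= h x.
  have q0 : 0 <= f x + g x - 2 * k x.
    rewrite kE -[f x in X in X - _]sqr_sqrtr// -[g x in X in X - _]sqr_sqrtr//.
    by have := sqr_ge0 (Num.sqrt (f x) - Num.sqrt (g x)); rewrite sqrrB; lra.
  apply: addr_ge0; apply: mulr_ge0 => //.
  - by rewrite invr_ge0 mulr_ge0// ltW.
  - exact: ltW.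
  - exact: addr_ge0.
have fgh x : f x <= g x + h x.
  rewrite -lerBlDl -subr_ge0 /h kE.
  set s := Num.sqrt (f x); set t := Num.sqrt (g x).
  rewrite -[f x]sqr_sqrtr// -[g x]sqr_sqrtr// -/s -/t.
  (* Young's inequality with weight [c] for [f - g = (s - t) (s + t)], where
     [(s + t)^2 = 2 (s^2 + t^2) - (s - t)^2]. *)
  rewrite (_ : _ - _ = (2 * c)^-1 * (((s - t) - c * (s + t)) ^+ 2 + c ^+ 2 * (s - t) ^+ 2)).
    apply: mulr_ge0; first by rewrite invr_ge0 mulr_ge0// ltW.
    by apply: addr_ge0; rewrite ?sqr_ge0// mulr_ge0// sqr_ge0.
  by field; rewrite gt_eqF.
have mf : measurable_fun setT f by exact: mmd.
have mg : measurable_fun setT g by exact: mmd.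
have mk : measurable_fun setT k by apply: measurable_funM => //; exact: mmd.
have mh : measurable_fun setT h.
  apply: measurable_funD; apply: measurable_funM => //; last exact: measurable_funD.
  apply: measurable_funB; first exact: measurable_funD.
  exact: measurable_funM.
have intf : (\int[lebesgue_cv R p]_x (f x)%:E = 1)%E by exact: integral_mvnormal_pdf.
have intg : (\int[lebesgue_cv R p]_x (g x)%:E = 1)%E by exact: integral_mvnormal_pdf.
have intk : (\int[lebesgue_cv R p]_x (k x)%:E = rho%:E)%E.
  under eq_integral do rewrite EFinM.
  rewrite ge0_integralZl_EFin//; last by exact: expR_ge0.
  - by rewrite integral_mvnormal_pdf mule1.
  - by move=> x _; rewrite lee_fin mvnormal_pdf_ge0.
  - by apply/measurable_EFinP; exact: mmd.
have inth : (\int[lebesgue_cv R p]_x (h x)%:E <= d%:E)%E.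
  (* The negative term of [h] is moved to the other side, so that only integrals of nonnegative
     functions are added; the finiteness of the integral of [h] comes out of this equation. *)
  have : (\int[lebesgue_cv R p]_x (h x)%:E + (c^-1 * rho)%:E =
          ((2 * c)^-1 + c)%:E * (1 + 1))%E.
    rewrite -{1}intf -intg -ge0_integralD//; last 4 first.
    - by move=> x _; rewrite lee_fin.
    - exact/measurable_EFinP.
    - by move=> x _; rewrite lee_fin.
    - exact/measurable_EFinP.
    rewrite -ge0_integralZl_EFin//; last 3 first.
    - by move=> x _; rewrite adde_ge0// lee_fin.
    - by apply: emeasurable_funD; exact/measurable_EFinP.
    - by rewrite addr_ge0 ?invr_ge0 ?mulr_ge0// ltW.
    rewrite EFinM -intk -ge0_integralZl_EFin//; last 3 first.
    - by move=> x _; rewrite lee_fin.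
    - exact/measurable_EFinP.
    - by rewrite invr_ge0 ltW.
    rewrite -ge0_integralD//; last 4 first.
    - by move=> x _; rewrite lee_fin.
    - exact/measurable_EFinP.
    - by move=> x _; rewrite -EFinM lee_fin mulr_ge0// invr_ge0 ltW.
    - by apply/measurable_EFinP; exact: measurable_funM.
    apply: eq_integral => x _; rewrite -!(EFinD, EFinM); rewrite /h; congr EFin.
    by field; rewrite gt_eqF.
  have : (0 <= \int[lebesgue_cv R p]_x (h x)%:E)%E.
    by apply: integral_ge0 => x _; rewrite lee_fin.
  case: (\int[_]_x _)%E => [r| |] // _; rewrite -!EFinD -EFinM lee_fin => -[hr].
  have r1 : 1 - D / 8 <= rho by rewrite /rho -mulNr; exact: expR_ge1Dx.
  have -> : r = ((2 * c)^-1 + c) * (1 + 1) - c^-1 * rho by rewrite -hr addrK.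
  have c1 : c^-1 * (1 - D / 8) <= c^-1 * rho by rewrite ler_wpM2l// invr_ge0 ltW.
  suff : ((2 * c)^-1 + c) * (1 + 1) - c^-1 * (1 - D / 8) = d by lra.
  by rewrite dD /c; field; rewrite gt_eqF.
have /le_trans : (\int[lebesgue_cv R p]_(x in A) (f x)%:E <=
    \int[lebesgue_cv R p]_(x in A) ((g x)%:E + (h x)%:E))%E.
  apply: ge0_le_integral => //.
  - by move=> x _; rewrite lee_fin f0.
  - by apply: measurable_funTS; exact/measurable_EFinP.
  - by apply: measurable_funTS; apply: emeasurable_funD; exact/measurable_EFinP.
  - by move=> x _; rewrite -EFinD lee_fin fgh.
apply; rewrite ge0_integralD//; last 4 first.
- by move=> x _; rewrite lee_fin.
- by apply: measurable_funTS; exact/measurable_EFinP.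
- by move=> x _; rewrite lee_fin.
- by apply: measurable_funTS; exact/measurable_EFinP.
apply: leeD => //; apply: le_trans inth.
apply: ge0_subset_integral => //; first exact/measurable_EFinP.
by move=> x _; rewrite lee_fin.
Qed.

End mvnormal_theory.
End mvnormal.

(** * Densities and quantile transforms *)

Section density.
Context d (T : measurableType d) (R : realType).
Context (mu : {measure set T -> \bar R}) (k : T -> \bar R).
Local Open Scope ereal_scope.

Definition density_measure (A : set T) : \bar R := \int[mu]_(x in A) k x.

Hypothesis mk : measurable_fun setT k.
Hypothesis k0 : forall x, 0 <= k x.

Let density0 : density_measure set0 = 0.
Proof. exact: integral_set0. Qed.

Let density_ge0 A : 0 <= density_measure A.
Proof. by apply: integral_ge0 => x _; exact: k0. Qed.

Lemma density_sigma_additive : semi_sigma_additive density_measure.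
Proof.
move=> F mF tF mUF; rewrite /density_measure ge0_integral_bigcup//; last first.
  exact: measurable_funTS.
by apply: is_cvg_ereal_nneg_natsum_cond => n _ _; exact: density_ge0.
Qed.

HB.instance Definition _ := isMeasure.Build _ _ _ density_measure
  density0 density_ge0 density_sigma_additive.

Import HBNNSimple.

(** Monotone convergence along simple functions; finiteness of [k] lets the factor [k x] pass to the
    limit. Both [trunc_normal] and [acda_kernel] are of the form [density_measure]. *)
Lemma integral_density (f : T -> \bar R) : (forall x, k x \is a fin_num) ->
  measurable_fun setT f -> (forall x, 0 <= f x) ->
  \int[density_measure]_x f x = \int[mu]_x (f x * k x).
Proof.
move=> kfin mf f0; pose h := nnsfun_approx measurableT mf.
have hf x : (h n x)%:E @[n --> \oo] --> f x.
  by apply: cvg_nnsfun_approx => // y _; exact: f0.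
have hnd x : {homo (fun n => (h n x)%:E) : a b / (a <= b)%N >-> a <= b}.
  by move=> a b ab; rewrite lee_fin; exact/lefP/nd_nnsfun_approx.
transitivity (limn (fun n => \int[density_measure]_x (h n x)%:E)).
{ rewrite -monotone_convergence//.
  - by apply: eq_integral => x _; apply/esym/cvg_lim => //; exact: hf.
  - by move=> n; exact/measurable_EFinP/measurable_funP.
  - by move=> n x _; rewrite lee_fin. }
have -> : \int[mu]_x (f x * k x) = limn (fun n => \int[mu]_x ((h n x)%:E * k x)).
{ rewrite -monotone_convergence//.
  - apply: eq_integral => x _; apply/esym/cvg_lim => //.
    by apply: cvgeZr; [exact: kfin|exact: hf].
  - move=> n; apply: emeasurable_funM => //.
    exact/measurable_EFinP/measurable_funP.
  - by move=> n x _; rewrite mule_ge0// lee_fin.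
  - by move=> x _ a b ab; rewrite lee_wpmul2r//; exact: hnd. }
apply/congr_lim/funext => n.
under [LHS]eq_integral do rewrite fimfunE -fsumEFin//.
rewrite ge0_integral_fsum//; last 2 first.
- by move=> y; exact/measurable_EFinP/measurable_funM.
- by move=> y x _; rewrite nnfun_muleindic_ge0.
transitivity (\int[mu]_x (\sum_(y \in range (h n))
    (y * \1_(h n @^-1` [set y]) x)%:E * k x)); last first.
  apply: eq_integral => x _; rewrite -ge0_mule_fsuml => [|y]; last exact: nnfun_muleindic_ge0.
  by rewrite fsumEFin // -(fimfunE _ x).
rewrite ge0_integral_fsum//; last 2 first.
- move=> y; apply: emeasurable_funM => //.
  exact/measurable_EFinP/measurable_funM.
- by move=> m y _; rewrite mule_ge0 ?nnfun_muleindic_ge0.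
apply: eq_fsbigr => r rhn.
rewrite integralZl_indic_nnsfun//.
under [RHS]eq_integral do rewrite EFinM -muleA.
rewrite ge0_integralZl//.
- rewrite integral_indic// setIT; congr (_ * _).
  rewrite /density_measure [LHS]integral_mkcond; apply: eq_integral => x _.
  by rewrite epatch_indic muleC.
- by apply: emeasurable_funM => //; exact/measurable_EFinP.
- by move=> t _; rewrite mule_ge0 ?lee_fin.
- by move: rhn; rewrite inE => -[t _ <-]; rewrite lee_fin.
Qed.

End density.

(** * The inverse transform and couplings on the line *)

Section quantile.
Context (R : realType) (P : probability (measurableTypeR R) R).
Local Open Scope measure_display_scope.

Let idTR : measurableTypeR R -> R := idfun.

#[local] HB.instance Definition _ :=
  @isMeasurableFun.Build _ _ _ _ idTR (@measurable_id _ _ setT).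

Definition cdf_fun (t : R) : R := fine (P `]-oo, t]%classic).

Let cdf_funE t : (cdf_fun t)%:E = cdf (idTR : {RV P >-> R}) t.
Proof.
by rewrite /cdf /distribution /pushforward preimage_id fineK// fin_num_measure.
Qed.

Lemma cdf_fun_nd : {homo cdf_fun : s t / s <= t}.
Proof. by move=> s t st; rewrite -lee_fin !cdf_funE; exact: cdf_nondecreasing. Qed.

Lemma cdf_fun_ge0 t : 0 <= cdf_fun t.
Proof. by rewrite -lee_fin cdf_funE; exact: cdf_ge0. Qed.

Lemma cdf_fun_le1 t : cdf_fun t <= 1.
Proof. by rewrite -lee_fin cdf_funE; exact: cdf_le1. Qed.

Let cdf_fun_cdf : cdf_fun = fine \o cdf (idTR : {RV P >-> R}).
Proof. by apply/funext => t /=; rewrite -cdf_funE. Qed.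

Lemma cdf_fun_cvgy : cdf_fun @ +oo --> (1 : R).
Proof. by rewrite cdf_fun_cdf; apply/fine_cvg/cvg_cdfy1. Qed.

Lemma cdf_fun_cvgNy : cdf_fun @ -oo --> (0 : R).
Proof. by rewrite cdf_fun_cdf; apply/fine_cvg/cvg_cdfNy0. Qed.

Lemma cdf_fun_right_continuous t : cdf_fun @ t^'+ --> cdf_fun t.
Proof.
rewrite cdf_fun_cdf; apply: fine_cvg; rewrite /= -cdf_funE /= cdf_funE.
exact: cdf_right_continuous.
Qed.

Definition quantile (u : R) : R := inf [set t | u <= cdf_fun t].

(** Galois connection between quantile function and distribution function. The limits at infinity
    make the set nonempty and bounded below, and right continuity puts its infimum into it. *)
Lemma quantile_le u t : 0 < u -> u < 1 -> (quantile u <= t) = (u <= cdf_fun t).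
Proof.
move=> u0 u1.
have ne : [set t | u <= cdf_fun t] !=set0.
  have /cvgr_ge /(_ _ u1) := cdf_fun_cvgy.
  by move=> /filter_ex[x ux]; exists x.
have lb : has_lbound [set t | u <= cdf_fun t].
  have /cvgr_lt /(_ _ u0) := cdf_fun_cvgNy.
  move=> /filter_ex[x xu]; exists x => s /= us.
  by rewrite leNgt; apply/negP => /ltW/cdf_fun_nd/(le_trans us); rewrite leNgt xu.
apply/idP/idP => [qt|ut]; last exact: ge_inf.
rewrite leNgt; apply/negP => Ft.
have /cvgr_lt /(_ _ Ft) h := @cdf_fun_right_continuous t.
have [s [ts su]] : exists s, t < s /\ cdf_fun s < u.
  near t^'+ => s; exists s; split; near: s => //; exact: nbhs_right_gt.
have : s <= quantile u.
  apply: lb_le_inf => // r /= ur; rewrite leNgt; apply/negP => /ltW/cdf_fun_nd.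
  by move=> /(le_trans ur); rewrite leNgt su.
by move=> /le_trans/(_ qt); rewrite leNgt ts.
Unshelve. all: by end_near. Qed.


(** The value [0] off the open unit interval is the same for all laws, so two such maps can be
    compared at every [u]. *)
Definition quantile_map (u : measurableTypeR R) : measurableTypeR R :=
  if u \in `]0, 1[ then quantile u else 0.

Lemma measurable_quantile_map : measurable_fun setT quantile_map.
Proof.
apply: (measurability (@RGenOInfty.G R)).
  exact: RGenOInfty.measurableE.
move=> _ [_ [t ->] <-]; rewrite setTI.
rewrite (_ : _ @^-1` _ = (`]0, 1[%classic `&` `]cdf_fun t, +oo[%classic) `|`
    (~` `]0, 1[%classic `&` [set _ : measurableTypeR R | t < 0])).
  apply: measurableU; apply: measurableI; [exact: measurable_itv|exact: measurable_itv| |].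
    by apply: measurableC; exact: measurable_itv.
  have [t0|t0] := boolP (t < 0).
    by rewrite (_ : [set _ | _] = setT)//; apply/seteqP; split.
  by rewrite (_ : [set _ | _] = set0)//; apply/seteqP; split.
apply/seteqP; split=> u /=; rewrite /quantile_map; case: ifPn => u01.
- rewrite in_itv/= andbT ltNge; move: u01; rewrite in_itv/= => /andP[u0 u1].
  by rewrite quantile_le// -ltNge => tu; left; rewrite in_itv/= tu.
- by rewrite in_itv/= andbT => t0; right.
- move: u01; rewrite in_itv/= => /andP[u0 u1] [[_]|[]//].
  by rewrite !in_itv/= !andbT [in X in _ -> X]ltNge quantile_le// -ltNge.
- by move=> [[//]|[_ t0]]; rewrite in_itv/= t0.
Qed.

Let mU : measurable (`]0, 1[%classic : set (measurableTypeR R)).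
Proof. exact: measurable_itv. Qed.

(** Inverse transform sampling. By [quantile_le] the two measures agree on the rays []t, +oo[], a
    generating family closed under intersection. *)
Lemma pushforward_quantile_map (A : set (measurableTypeR R)) : measurable A ->
  pushforward (mrestr lebesgue_measure mU) quantile_map A = P A.
Proof.
move=> mA.
pose g (k : nat) : set (measurableTypeR R) := `]- k%:R, +oo[%classic.
apply: (@measure_unique _ R (measurableTypeR R) (@RGenOInfty.G R) g) => //.
- exact: RGenOInfty.measurableE.
- move=> _ _ [a ->] [b ->]; exists (Num.max a b).
  apply/seteqP; split=> x /=; rewrite !in_itv/= !andbT gt_max.
    by move=> [-> ->].
  by move=> /andP.
- by move=> k; exists (- k%:R).
- apply/seteqP; split=> // x _; exists (Num.truncn `|x|).+1 => //=.
  rewrite /g/= in_itv/= andbT ltrNl (le_lt_trans (ler_norm _))// normrN.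
  exact: truncnS_gt.
- exact: measurable_quantile_map.
- move=> mq _ [t ->].
  have F0 := cdf_fun_ge0 t; have F1 := cdf_fun_le1 t.
  rewrite /= /pushforward /mrestr.
  transitivity (lebesgue_measure `]cdf_fun t, 1[%classic).
    congr lebesgue_measure; apply/seteqP; split=> u /=.
      move=> [+ u01]; rewrite /quantile_map u01; move: u01.
      rewrite !in_itv/= !andbT => /andP[u0 u1].
      by rewrite ltNge quantile_le// -ltNge u1 => ->.
    rewrite !in_itv/= => /andP[tu u1]; have u0 := le_lt_trans F0 tu.
    by rewrite /quantile_map !in_itv/= u0 u1/= andbT ltNge quantile_le// -ltNge.
  rewrite lebesgue_measure_itv/= lte_fin.
  transitivity (1 - (cdf_fun t)%:E)%E.
    case: ifPn => [//|].
    by rewrite -leNgt => /(conj F1)/andP/le_anti ->; rewrite subee.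
  rewrite /cdf_fun fineK ?fin_num_measure// -probability_setC//.
  by rewrite setCitvl.
- move=> mq k; apply: (@le_lt_trans _ _ (lebesgue_measure (`]0, 1[%classic : set R))).
    rewrite /= /pushforward /mrestr; apply: le_measure; rewrite ?inE//.
    apply: measurableI => //; rewrite -[X in measurable X]setTI.
    by apply: measurable_quantile_map => //; exact: measurable_itv.
  by rewrite lebesgue_measure_itv/= lte_fin ltr01 sube0 ltry.
Qed.

Lemma integral_quantile_map (f : measurableTypeR R -> \bar R) :
  measurable_fun setT f -> (forall x, 0 <= f x)%E ->
  (\int[P]_x f x = \int[mrestr lebesgue_measure mU]_u f (quantile_map u))%E.
Proof.
move=> mf f0.
have := @ge0_integral_pushforward _ _ _ _ R _ measurable_quantile_map
  (mrestr lebesgue_measure mU) setT f measurableT mf (fun y _ => f0 y).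
rewrite preimage_setT => <-.
apply: eq_measure_integral => [|mq A mA _]; first exact: measurable_quantile_map.
exact/esym/pushforward_quantile_map.
Qed.

End quantile.

Section quantile_coupling.
Context (R : realType).
Notation PR := (probability (measurableTypeR R) R).
Implicit Types P : PR.

Lemma quantile_shift_le P P' (e : R) u : 0 < u -> u < 1 ->
  (forall t, cdf_fun P t <= cdf_fun P' (t + e)) ->
  quantile P' u <= quantile P u + e.
Proof.
move=> u0 u1 h; rewrite quantile_le//; apply: le_trans (h _).
by rewrite -quantile_le.
Qed.

(** Both laws are images of one uniform variable, and the two shift conditions keep the images
    within [e], so the integrands are compared pointwise. The functions [f] and [f'] are distinct
    because, in the product case, each is an inner integral with its own means. *)
Lemma integral_quantile_coupling P P' (e c : R) (f f' : measurableTypeR R -> \bar R) :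
  0 <= e -> 0 <= c ->
  (forall t, cdf_fun P t <= cdf_fun P' (t + e)) ->
  (forall t, cdf_fun P' t <= cdf_fun P (t + e)) ->
  measurable_fun setT f -> (forall x, 0 <= f x)%E ->
  measurable_fun setT f' -> (forall x, 0 <= f' x)%E ->
  (forall s s' : R, `|s - s'| <= e -> (f s <= f' s' + c%:E)%E) ->
  (\int[P]_x f x <= \int[P']_x f' x + c%:E)%E.
Proof.
move=> e0 c0 PP' P'P mf f0 mf' f'0 ff'.
rewrite !integral_quantile_map//.
have mq (Q : PR) : measurable_fun setT (quantile_map Q) by exact: measurable_quantile_map.
set mu := mrestr _ _.
have mu1 : mu setT = 1%E.
  by rewrite /mu /mrestr setTI lebesgue_measure_itv/= lte_fin ltr01 sube0.
have -> : (c%:E = \int[mu]_u c%:E)%E.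
  by rewrite integral_cst// [X in (_ * X)%E]mu1 mule1.
rewrite -ge0_integralD//; last first.
  exact: (measurableT_comp mf' (mq P')).
apply: ge0_le_integral => //.
- exact: (measurableT_comp mf (mq P)).
- apply: emeasurable_funD => //.
  exact: (measurableT_comp mf' (mq P')).
- move=> u _; apply: ff'; rewrite /quantile_map.
  case: ifPn => [|_]; last by rewrite subrr normr0.
  rewrite in_itv/= => /andP[u0 u1].
  have := quantile_shift_le u0 u1 PP'; have := quantile_shift_le u0 u1 P'P.
  by rewrite ler_norml; lra.
Qed.

End quantile_coupling.

(** * Truncated normal distributions *)

Section truncated_normal.
Context (R : realType).
Implicit Types (m t : R) (A B : set (measurableTypeR R)).

Lemma normal_pdf1E m x :
  normal_pdf m 1 x = normal_peak 1 * expR (- (x - m) ^+ 2 / 2).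
Proof. by rewrite normal_pdfE ?oner_eq0// /normal_fun expr1n. Qed.

Lemma measurable_half_line b : measurable (half_line b : set (measurableTypeR R)).
Proof. by case: b; exact: measurable_itv. Qed.

Definition nprob m A : R := fine (normal_prob m 1 A).

Lemma nprobE m A : measurable A -> (nprob m A)%:E = normal_prob m 1 A.
Proof. by move=> mA; rewrite fineK// fin_num_measure. Qed.

Lemma nprob_ge0 m A : 0 <= nprob m A.
Proof. exact: fine_ge0. Qed.

Lemma nprob_le m A B : measurable A -> measurable B -> A `<=` B ->
  nprob m A <= nprob m B.
Proof. by move=> mA mB AB; rewrite -lee_fin !nprobE// le_measure ?inE. Qed.

Lemma nprob_le1 m A : measurable A -> nprob m A <= 1.
Proof. by move=> mA; rewrite -lee_fin nprobE// probability_le1. Qed.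

Lemma nprob_split m A B : measurable A -> measurable B ->
  nprob m B = nprob m (A `&` B) + nprob m (~` A `&` B).
Proof.
move=> mA mB; have mA' := measurableC mA.
apply: EFin_inj; rewrite EFinD !nprobE//; try exact: measurableI.
rewrite -measureU//; try exact: measurableI.
  by rewrite -setIUl setUv setTI.
by rewrite setIACA setICr set0I.
Qed.

Lemma nprob_setC m A : measurable A -> nprob m (~` A) = 1 - nprob m A.
Proof.
move=> mA; apply: EFin_inj; rewrite EFinB !nprobE//; last exact: measurableC.
exact: probability_setC.
Qed.

Lemma normal_prob_indic m A : measurable A ->
  normal_prob m 1 A = (\int[lebesgue_measure]_x (normal_pdf m 1 x * \1_A x)%:E)%E.
Proof.
move=> mA; rewrite /normal_prob integral_mkcond; apply: eq_integral => x _.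
by rewrite epatch_indic -EFinM.
Qed.

Lemma measurable_preimage_addr A (e : R) : measurable A ->
  measurable ([set x | A (x + e)] : set (measurableTypeR R)).
Proof.
move=> mA; rewrite -[X in measurable X]setTI.
have : measurable_fun setT (fun x : measurableTypeR R => x + e : measurableTypeR R).
  exact: measurable_funD.
exact.
Qed.

Lemma nprob_shift m e A : measurable A ->
  nprob (m + e) A = nprob m [set x | A (x + e)].
Proof.
move=> mA; rewrite /nprob !normal_prob_indic//; last exact: measurable_preimage_addr.
rewrite -(@integral_translation _ (fun x => (normal_pdf (m + e) 1 x * \1_A x)%:E) e).
- congr fine; apply: eq_integral => x _; rewrite !normal_pdf1E.
  by rewrite opprD addrACA subrr addr0.
- apply/measurable_EFinP; apply: measurable_funM; first exact: measurable_normal_pdf.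
  exact: measurable_indic.
- by move=> x; rewrite lee_fin mulr_ge0// ?normal_pdf_ge0.
Qed.

Lemma nprob_half_line_gt0 m b : 0 < nprob m (half_line b).
Proof.
(* [J] is []0, 1]] or []-2, -1]]: a unit interval inside the half line, on which the density is at
   least [k]. *)
pose a : R := if b then 1 else -1.
pose J : set (measurableTypeR R) := `]a - 1, a]%classic.
have mJ : measurable J by exact: measurable_itv.
have JB : J `<=` half_line b.
  by rewrite /J /a /half_line => x; case: (b); rewrite /= !in_itv/= ?andbT; lra.
apply: lt_le_trans (nprob_le m mJ (measurable_half_line b) JB).
pose k := normal_peak 1 * expR (- (`|a - m| + 1) ^+ 2 / 2).
have k0 : 0 < k by rewrite mulr_gt0 ?expR_gt0// normal_peak_gt0// oner_eq0.
apply: (lt_le_trans k0); rewrite -lee_fin nprobE//.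
have -> : (k%:E = \int[lebesgue_measure]_(x in J) k%:E)%E.
  rewrite integral_cst//= /J lebesgue_measure_itv/= lte_fin ltrBlDr ltrDl ltr01.
  by rewrite -EFinB opprB addrC subrK mule1.
apply: ge0_le_integral => //.
- by move=> x _; rewrite lee_fin ltW.
- by apply: measurable_funTS; apply/measurable_EFinP; exact: measurable_normal_pdf.
- move=> x; rewrite /J /= in_itv/= => /andP[ax xa].
  rewrite lee_fin normal_pdf1E ler_pM2l ?normal_peak_gt0 ?oner_eq0// ler_expR.
  rewrite !mulNr lerN2 ler_pM2r ?invr_gt0// -ler_sqrt ?sqr_ge0//.
  rewrite !sqrtr_sqr (ger0_norm (x := _ + 1)); last by rewrite addr_ge0.
  have -> : x - m = (a - m) + (x - a) by ring.
  apply: le_trans (ler_normD _ _) _; rewrite lerD2l ler_norml; lra.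
Qed.

(* Integrated monotone likelihood ratio property: the ratio of the densities is
   increasing, and [r] below is its value at [t]. *)
Lemma nprob_mlr m m' t B : measurable B -> m <= m' ->
  nprob m' (`]-oo, t] `&` B) * nprob m (~` `]-oo, t] `&` B) <=
  nprob m (`]-oo, t] `&` B) * nprob m' (~` `]-oo, t] `&` B).
Proof.
move=> mB mm'; set I : set (measurableTypeR R) := `]-oo, t]%classic.
have mI : measurable I by exact: measurable_itv.
have mIB : measurable (I `&` B) by exact: measurableI.
have mCB : measurable (~` I `&` B) by apply: measurableI => //; exact: measurableC.
pose r := expR ((m' - m) * t - (m' ^+ 2 - m ^+ 2) / 2).
have r0 : 0 < r by exact: expR_gt0.
have pk : 0 < normal_peak (1 : R) by rewrite normal_peak_gt0// oner_eq0.
have prE x : r * normal_pdf m 1 x =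
    normal_peak 1 * expR (- (x - m') ^+ 2 / 2 + (m' - m) * (t - x)).
  rewrite normal_pdf1E mulrCA -expRD; congr (_ * expR _); by field.
have scale m0 c A : 0 <= c -> measurable A ->
    (c * nprob m0 A)%:E =
    (\int[lebesgue_measure]_(x in A) (c * normal_pdf m0 1 x)%:E)%E.
  move=> c0 mA; under eq_integral do rewrite EFinM.
  rewrite ge0_integralZl_EFin//.
  - by rewrite EFinM nprobE.
  - by move=> x _; rewrite lee_fin normal_pdf_ge0.
  - by apply: measurable_funTS; apply/measurable_EFinP; exact: measurable_normal_pdf.
have mpdf m0 c A : measurable_fun A (fun x => (c * normal_pdf m0 1 x)%:E).
  apply: measurable_funTS; apply/measurable_EFinP; apply: measurable_funM => //.
  exact: measurable_normal_pdf.
have h1 : nprob m' (I `&` B) <= r * nprob m (I `&` B).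
  rewrite -lee_fin scale ?(ltW r0)// -[nprob m' _]mul1r scale//.
  apply: ge0_le_integral => //.
  - by move=> x _; rewrite lee_fin mulr_ge0// normal_pdf_ge0.
  - move=> x [+ _]; rewrite /I /= in_itv/= => xt; rewrite lee_fin mul1r prE normal_pdf1E.
    by rewrite ler_pM2l// ler_expR lerDl mulr_ge0// subr_ge0.
have h2 : r * nprob m (~` I `&` B) <= nprob m' (~` I `&` B).
  rewrite -lee_fin scale ?(ltW r0)// -[nprob m' _]mul1r scale//.
  apply: ge0_le_integral => //.
  - by move=> x _; rewrite lee_fin mulr_ge0// ?normal_pdf_ge0// ltW.
  - move=> x [+ _]; rewrite /I /= in_itv/= => /negP; rewrite -ltNge => xt.
    rewrite lee_fin mul1r prE normal_pdf1E ler_pM2l// ler_expR gerDl.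
    by rewrite mulr_ge0_le0// ?subr_ge0// subr_le0 ltW.
have h3 := nprob_ge0 m (I `&` B); have h4 := nprob_ge0 m (~` I `&` B).
apply: (@le_trans _ _ (r * nprob m (I `&` B) * nprob m (~` I `&` B))).
  exact: ler_wpM2r.
by rewrite -mulrA mulrCA; apply: ler_wpM2l.
Qed.

End truncated_normal.

Section trunc_normal.
Context (R : realType).
Implicit Types (A : set (measurableTypeR R)).

Context (m : R) (b : bool).
Let B : set (measurableTypeR R) := half_line b.
Let mB : measurable B. Proof. exact: measurable_half_line. Qed.

Lemma truncated_normal_pdf_ge0 x : 0 <= truncated_normal_pdf m B x.
Proof. by rewrite divr_ge0 ?nprob_ge0// mulr_ge0// normal_pdf_ge0. Qed.

Lemma measurable_truncated_normal_pdf :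
  measurable_fun setT (truncated_normal_pdf m B : measurableTypeR R -> R).
Proof.
apply: measurable_funM => //; apply: measurable_funM.
  exact: measurable_normal_pdf.
exact: measurable_indic.
Qed.

Definition trunc_normal : set (measurableTypeR R) -> \bar R :=
  density_measure lebesgue_measure (fun x : measurableTypeR R => (truncated_normal_pdf m B x)%:E).

Lemma trunc_normalE A : measurable A ->
  trunc_normal A = (nprob m (A `&` B) / nprob m B)%:E.
Proof.
move=> mA; rewrite EFinM muleC nprobE; last exact: measurableI.
rewrite /normal_prob -ge0_integralZl_EFin//.
- rewrite [RHS]integral_mkcondr; apply: eq_integral => x _.
  rewrite epatch_indic /truncated_normal_pdf -!EFinM; congr EFin.
  by rewrite /nprob mulrC mulrA.
- exact: measurableI.
- by move=> x _; rewrite lee_fin normal_pdf_ge0.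
- by apply: measurable_funTS; apply/measurable_EFinP; exact: measurable_normal_pdf.
- by rewrite invr_ge0 nprob_ge0.
Qed.

Let mk : measurable_fun setT (fun x : measurableTypeR R => (truncated_normal_pdf m B x)%:E).
Proof. by apply/measurable_EFinP; exact: measurable_truncated_normal_pdf. Qed.

Let k0 x : (0 <= (truncated_normal_pdf m B x)%:E)%E.
Proof. by rewrite lee_fin truncated_normal_pdf_ge0. Qed.

Let trunc0 : trunc_normal set0 = 0%E.
Proof. exact: integral_set0. Qed.

Let trunc_ge0 A : (0 <= trunc_normal A)%E.
Proof. by apply: integral_ge0 => x _; exact: k0. Qed.

Let trunc_sigma_additive : semi_sigma_additive trunc_normal.
Proof. exact: (density_sigma_additive (mu := lebesgue_measure) mk k0). Qed.

HB.instance Definition _ := isMeasure.Build _ _ _ trunc_normal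
  trunc0 trunc_ge0 trunc_sigma_additive.

Let trunc_setT : trunc_normal setT = 1%E.
Proof. by rewrite trunc_normalE// setTI divff// gt_eqF// nprob_half_line_gt0. Qed.

HB.instance Definition _ :=
  @Measure_isProbability.Build _ _ R trunc_normal trunc_setT.

Lemma integral_trunc_normal (f : R -> \bar R) : measurable_fun setT f ->
  (forall x, 0 <= f x)%E ->
  (\int[trunc_normal]_x f x =
   \int[lebesgue_measure]_x ((truncated_normal_pdf m B x)%:E * f x))%E.
Proof.
move=> mf f0.
rewrite (integral_density lebesgue_measure mk k0)//.
by apply: eq_integral => x _; rewrite muleC.
Qed.

End trunc_normal.

Section trunc_coupling.
Context (R : realType).
Implicit Types (m t : R) (b : bool).

(** The fraction increases with the odds [x : y], so inequalities between truncated distribution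
    functions reduce to cross products such as those in [nprob_mlr]. *)
Lemma ler_ratio (x y x' y' : R) : 0 < x + y -> 0 < x' + y' ->
  x * y' <= x' * y -> x / (x + y) <= x' / (x' + y').
Proof.
move=> s s' h; rewrite ler_pdivrMr// mulrAC ler_pdivlMr//.
by rewrite !mulrDr [x * x']mulrC lerD2l.
Qed.

Let I t : set (measurableTypeR R) := `]-oo, t]%classic.
Let mI t : measurable (I t). Proof. exact: measurable_itv. Qed.

Lemma trunc_cdfE m b t :
  cdf_fun (trunc_normal m b) t =
  nprob m (I t `&` half_line b) /
  (nprob m (I t `&` half_line b) + nprob m (~` I t `&` half_line b)).
Proof.
rewrite /cdf_fun [X in fine X](trunc_normalE m b (mI t))/=.
by rewrite -nprob_split//; exact: measurable_half_line.
Qed.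

Lemma trunc_split_gt0 m b t :
  0 < nprob m (I t `&` half_line b) + nprob m (~` I t `&` half_line b).
Proof.
rewrite -nprob_split//; first exact: nprob_half_line_gt0.
exact: measurable_half_line.
Qed.

Lemma trunc_cdf_mono m m' b t : m <= m' ->
  cdf_fun (trunc_normal m' b) t <= cdf_fun (trunc_normal m b) t.
Proof.
move=> mm'; rewrite [leLHS]trunc_cdfE [leRHS]trunc_cdfE.
apply: ler_ratio; [exact: trunc_split_gt0|exact: trunc_split_gt0|].
by apply: nprob_mlr mm'; exact: measurable_half_line.
Qed.

(* Shifting back by [e], the half line changes only above [t] (lower half line)
   or only below [t] (upper half line), unless one of the two sides of the
   inequality between products vanishes. *)
Lemma trunc_cdf_shift m e b t : 0 <= e ->
  cdf_fun (trunc_normal m b) t <= cdf_fun (trunc_normal (m + e) b) (t + e).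
Proof.
move=> e0; rewrite [leLHS]trunc_cdfE [leRHS]trunc_cdfE; apply: ler_ratio; [exact: trunc_split_gt0|exact: trunc_split_gt0|].
have mB := measurable_half_line b.
have mIB s : measurable (I s `&` half_line b) by exact: measurableI.
have mCB s : measurable (~` I s `&` half_line b).
  by apply: measurableI => //; exact: measurableC.
rewrite !nprob_shift//.
set x := nprob _ _; set y' := nprob _ _; set x' := nprob _ _; set y := nprob _ _.
have x0 : 0 <= x by exact: nprob_ge0.
have y0 : 0 <= y by exact: nprob_ge0.
have x'0 : 0 <= x' by exact: nprob_ge0.
have y'0 : 0 <= y' by exact: nprob_ge0.
have := @measurable_preimage_addr R; move=> mp.
case: b => [|] in mB mIB mCB x x0 y y0 x' x'0 y' y'0 *.
- have [t0|t0] := ltP t 0.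
    rewrite (_ : x = 0) ?mul0r ?mulr_ge0//.
    rewrite /x (_ : _ `&` _ = set0) /nprob ?measure0//.
    by apply/seteqP; split=> // s []; rewrite /I /half_line /= !in_itv/= andbT; lra.
  apply: ler_pM => //; apply: nprob_le; [by []|exact: mp| |exact: mp|by []|].
    move=> s []; rewrite /I /half_line /= !in_itv/= !andbT; lra.
  move=> s []; rewrite /I /half_line /= !in_itv/= !andbT => /negP; rewrite -ltNge => h1 h2.
  by split; [apply/negP; rewrite -ltNge|]; lra.
- have [t0|t0] := ltP t (- e).
    apply: ler_pM => //; apply: nprob_le; [by []|exact: mp| |exact: mp|by []|].
      move=> s []; rewrite /I /half_line /= !in_itv/=; lra.
    move=> s []; rewrite /I /half_line /= !in_itv/= => /negP; rewrite -ltNge => h1 h2.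
    by split; [apply/negP; rewrite -ltNge|]; lra.
  rewrite (_ : y' = 0) ?mulr0 ?mulr_ge0//.
  rewrite /y' (_ : [set _ | _] = set0) /nprob ?measure0//.
  apply/seteqP; split=> // s []; rewrite /I /half_line /= !in_itv/= => /negP; rewrite -ltNge; lra.
Qed.

(** For [m <= m'] this is the shift inequality; otherwise monotonicity in the mean gives it even
    without displacement. Applied in both orders, it yields the two conditions of the quantile
    coupling. *)
Lemma trunc_cdf_le m m' b t :
  cdf_fun (trunc_normal m b) t <= cdf_fun (trunc_normal m' b) (t + `|m - m'|).
Proof.
have [mm'|/ltW mm'] := leP m m'.
  have mE : m + (m' - m) = m' by rewrite addrC subrK.
  have m0 : 0 <= m' - m by rewrite subr_ge0.
  by have := trunc_cdf_shift m b t m0; rewrite mE distrC ger0_norm.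
apply: le_trans (trunc_cdf_mono b t mm') _; apply: cdf_fun_nd.
by rewrite lerDl.
Qed.

End trunc_coupling.

Section trunc_coupling.
Context (R : realType).
Implicit Types (m t : R) (b : bool).
Lemma trunc_normal_coupling m m' b (c : R) (f f' : R -> \bar R) : 0 <= c ->
  measurable_fun setT f -> (forall x, 0 <= f x)%E ->
  measurable_fun setT f' -> (forall x, 0 <= f' x)%E ->
  (forall s s' : R, `|s - s'| <= `|m - m'| -> (f s <= f' s' + c%:E)%E) ->
  (\int[lebesgue_measure]_x
     ((truncated_normal_pdf m (half_line b) x)%:E * f x) <=
   \int[lebesgue_measure]_x
     ((truncated_normal_pdf m' (half_line b) x)%:E * f' x) + c%:E)%E.
Proof.
move=> c0 mf f0 mf' f'0 ff'; 
have E1 := integral_trunc_normal m b mf f0.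
have E2 := integral_trunc_normal m' b mf' f'0.
rewrite -[leLHS]E1 -[X in (X + _)%E]E2.
have h1 t := trunc_cdf_le m m' b t.
have h2 t := trunc_cdf_le m' m b t.
rewrite distrC in h2.
exact: (integral_quantile_coupling (normr_ge0 _) c0 h1 h2 mf f0 mf' f'0 ff').
Qed.

End trunc_coupling.

(** * Products of truncated normal laws *)

Section trunc_prod.
Context (R : realType).
Definition trunc_prod n (m : 'cV[R]_n) (b : 'I_n -> bool) (z : 'cV[R]_n) : R :=
  \prod_(i < n) truncated_normal_pdf (m i ord0) (half_line (b i)) (z i ord0).

Lemma trunc_prod_ge0 n (m : 'cV[R]_n) b z : 0 <= trunc_prod m b z.
Proof. by apply: prodr_ge0 => i _; exact: truncated_normal_pdf_ge0. Qed.

Lemma measurable_trunc_prod n (m : 'cV[R]_n) b :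
  measurable_fun setT (trunc_prod m b).
Proof.
apply: measurable_prod => i _.
apply: (measurableT_comp (measurable_truncated_normal_pdf _ _)).
exact: measurable_coord.
Qed.

Lemma cons_cv0 n (t : R) (x : 'cV[R]_n) : cons_cv (t, x) ord0 ord0 = t.
Proof. by rewrite -[LHS]/((uncons_cv _).1) cons_cvK. Qed.

Lemma cons_cvS n (t : R) (x : 'cV[R]_n) i : cons_cv (t, x) (lift ord0 i) ord0 = x i ord0.
Proof.
rewrite /cons_cv (_ : lift ord0 i = rshift 1 i) ?(@col_mxEd _ 1 n 1)//.
exact/val_inj.
Qed.

Lemma trunc_prod_cons n (m : 'cV[R]_n.+1) (b : 'I_n.+1 -> bool) t (x : 'cV[R]_n) :
  trunc_prod m b (cons_cv (t, x)) =
  truncated_normal_pdf (m ord0 ord0) (half_line (b ord0)) t *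
  trunc_prod (\col_i m (lift ord0 i) ord0) (fun i => b (lift ord0 i)) x.
Proof.
rewrite /trunc_prod big_ord_recl cons_cv0; congr (_ * _).
by apply: eq_bigr => i _; rewrite mxE cons_cvS.
Qed.

(* Functional form of the product of the one-dimensional quantile couplings. *)
Lemma trunc_prod_coupling n (m m' : 'cV[R]_n) b (c : R) (f f' : 'cV[R]_n -> \bar R) :
  0 <= c ->
  measurable_fun setT f -> (forall x, 0 <= f x)%E ->
  measurable_fun setT f' -> (forall x, 0 <= f' x)%E ->
  (forall z z' : 'cV[R]_n,
     (forall i, `|z i ord0 - z' i ord0| <= `|m i ord0 - m' i ord0|) ->
     (f z <= f' z' + c%:E)%E) ->
  (\int[lebesgue_cv R n]_z ((trunc_prod m b z)%:E * f z) <=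
   \int[lebesgue_cv R n]_z ((trunc_prod m' b z)%:E * f' z) + c%:E)%E.
Proof.
have mw k (m0 : 'cV[R]_k) b0 (g : 'cV[R]_k -> \bar R) : measurable_fun setT g ->
    measurable_fun setT (fun z => (trunc_prod m0 b0 z)%:E * g z)%E.
  move=> mg; apply: emeasurable_funM => //; apply/measurable_EFinP.
  exact: measurable_trunc_prod.
have w0 k (m0 : 'cV[R]_k) b0 (g : 'cV[R]_k -> \bar R) : (forall x, 0 <= g x)%E ->
    (forall z, 0 <= (trunc_prod m0 b0 z)%:E * g z)%E.
  by move=> g0 z; rewrite mule_ge0// lee_fin trunc_prod_ge0.
elim: n m m' b f f' => [|n IH] m m' b f f' c0 mf f0 mf' f'0 ff'.
  rewrite !integral_cv0; try exact: mw.
  by rewrite /trunc_prod !big_ord0 !mul1e; apply: ff'; case.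
rewrite !integral_cv_cons1; try (exact: mw || exact: w0).
have step (m0 : 'cV[R]_n.+1) g : measurable_fun setT g -> (forall x, 0 <= g x)%E ->
  (\int[lebesgue_measure]_t \int[lebesgue_cv R n]_x
     ((trunc_prod m0 b (cons_cv (t, x)))%:E * g (cons_cv (t, x))) =
   \int[lebesgue_measure]_t
     ((truncated_normal_pdf (m0 ord0 ord0) (half_line (b ord0)) t)%:E *
      \int[lebesgue_cv R n]_x
        ((trunc_prod (\col_i m0 (lift ord0 i) ord0) (fun i => b (lift ord0 i)) x)%:E *
         g (cons_cv (t, x)))))%E.
  move=> mg g0; apply: eq_integral => t _.
  under eq_integral do rewrite trunc_prod_cons EFinM -muleA.
  rewrite ge0_integralZl_EFin//.
  - by move=> x _; exact: (w0 _ _ _ (fun x => g (cons_cv (t, x)))).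
  - exact: (mw _ _ _ (fun x => g (cons_cv (t, x))) (measurable_cons_r t mg)).
  - exact: truncated_normal_pdf_ge0.
rewrite !step//.
have mS (m0 : 'cV[R]_n) b0 (g : 'cV[R]_n.+1 -> \bar R) : measurable_fun setT g ->
    (forall x, 0 <= g x)%E ->
    measurable_fun setT (fun t => \int[lebesgue_cv R n]_x
      ((trunc_prod m0 b0 x)%:E * g (cons_cv (t, x))))%E.
  move=> mg g0.
  apply: (measurable_fun_fubini_tonelli_F
    (fun tx => (trunc_prod m0 b0 tx.2)%:E * g (cons_cv tx))%E).
    apply: emeasurable_funM; last exact: measurable_cons_pair.
    apply/measurable_EFinP; apply: measurableT_comp => //.
    exact: measurable_trunc_prod.
  by move=> tx; exact: (w0 _ _ _ (fun x => g (cons_cv (tx.1, x)))).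
(* The first coordinate is coupled on the line, with the integrals over the other coordinates as
   test functions; the induction hypothesis compares these. *)
apply: trunc_normal_coupling => //.
- exact: mS.
- by move=> t; apply: integral_ge0 => x _; exact: (w0 _ _ _ (fun x => f (cons_cv (t, x)))).
- exact: mS.
- by move=> t; apply: integral_ge0 => x _; exact: (w0 _ _ _ (fun x => f' (cons_cv (t, x)))).
- move=> s s' ss'; apply: IH => //; try exact: measurable_cons_r.
  move=> z z' zz'; apply: ff' => i; case: (unliftP ord0 i) => [j ->|->].
    by have := zz' j; rewrite !cons_cvS !mxE.
  by rewrite !cons_cv0.
Qed.

End trunc_prod.

(** * Joint measurability in parameters and variables *)

Section joint_measurability.
Context (R : realType).

Lemma measurable_fun_inv_ge0 d (T : measurableType d) (f : T -> R) :
  measurable_fun setT f -> (forall x, 0 <= f x) ->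
  measurable_fun setT (fun x => (f x)^-1).
Proof.
move=> mf f0; rewrite (_ : (fun x => _) = (fun x => f x `^ (-1))).
  exact: (measurableT_comp (measurable_powR (-1)) mf).
by apply/funext => x; rewrite powR_inv1.
Qed.

Lemma measurable_normal_pdf1 d (T : measurableType d) (f g : T -> R) :
  measurable_fun setT f -> measurable_fun setT g ->
  measurable_fun setT (fun x => normal_pdf (f x) 1 (g x)).
Proof.
move=> mf mg; under eq_fun do rewrite normal_pdf1E.
apply: measurable_funM => //; apply: measurableT_comp => //.
apply: measurable_funM => //; apply: measurableT_comp => //.
by apply: measurable_funX; exact: measurable_funB.
Qed.

Lemma measurable_nprob (A : set (measurableTypeR R)) : measurable A ->
  measurable_fun setT (fun m : measurableTypeR R => nprob m A).
Proof.
move=> mA; apply/measurable_EFinP.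
rewrite (_ : _ \o _ = fun m : measurableTypeR R => (\int[lebesgue_measure]_x (normal_pdf m 1 x * \1_A x)%:E)%E).
  apply: (measurable_fun_fubini_tonelli_F
    (fun mx : measurableTypeR R * measurableTypeR R => (normal_pdf mx.1 1 mx.2 * \1_A mx.2)%:E)).
    apply/measurable_EFinP; apply: measurable_funM.
      exact: measurable_normal_pdf1.
    by apply: measurableT_comp => //; exact: measurable_indic.
  by move=> mx; rewrite lee_fin mulr_ge0// normal_pdf_ge0.
by apply/funext => m; rewrite /= nprobE// normal_prob_indic.
Qed.

Lemma measurable_truncated_normal_pdf2 d (T : measurableType d) (f g : T -> R) b :
  measurable_fun setT f -> measurable_fun setT g ->
  measurable_fun setT (fun x => truncated_normal_pdf (f x) (half_line b) (g x)).
Proof.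
move=> mf mg; have mB := measurable_half_line (R := R) b.
apply: measurable_funM; last first.
  apply: measurable_fun_inv_ge0 => [|x]; last exact: nprob_ge0.
  exact: (measurableT_comp (measurable_nprob mB) mf).
apply: measurable_funM; first exact: measurable_normal_pdf1.
by apply: (measurableT_comp _ mg); exact: measurable_indic.
Qed.

Lemma measurable_trunc_prod2 d (T : measurableType d) n (f g : T -> 'cV[R]_n) b :
  measurable_fun setT f -> measurable_fun setT g ->
  measurable_fun setT (fun x => trunc_prod (f x) b (g x)).
Proof.
move=> mf mg; apply: measurable_prod => i _.
by apply: measurable_truncated_normal_pdf2; exact: measurable_fun_entry.
Qed.

Lemma integral_trunc_prod n (m : 'cV[R]_n) b :
  (\int[lebesgue_cv R n]_z (trunc_prod m b z)%:E = 1)%E.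
Proof.
have mw k (m0 : 'cV[R]_k) b0 : measurable_fun setT (fun z => (trunc_prod m0 b0 z)%:E).
  by apply/measurable_EFinP; exact: measurable_trunc_prod.
elim: n m b => [|n IH] m b; first by rewrite integral_cv0// /trunc_prod big_ord0.
rewrite integral_cv_cons1//; last by move=> x; rewrite lee_fin trunc_prod_ge0.
under eq_integral => t _.
  under eq_integral do rewrite trunc_prod_cons EFinM.
  rewrite ge0_integralZl_EFin//; last 2 first.
  - by move=> x _; rewrite lee_fin trunc_prod_ge0.
  - exact: truncated_normal_pdf_ge0.
  rewrite IH; over.
rewrite /=.
have m1 : measurable_fun setT (cst 1%E : R -> \bar R) by exact: measurable_cst.
have := integral_trunc_normal (m ord0 ord0) (b ord0) m1 (fun x => lee01).
by rewrite integral_cst// [X in (_ * X)%E]probability_setT mule1 => <-.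
Qed.

End joint_measurability.

(** * The data augmentation step *)

Section da_step.
Context (R : realType) (n p : nat) (X : 'M[R]_(n, p)) (y : 'I_n -> bool).
Context (Q : 'M[R]_p) (v : 'cV[R]_p).
Hypothesis dQ : sym_posdef Q.
Local Open Scope ereal_scope.

Let M := (X^T *m X + Q)%R.
Let dM : sym_posdef M. Proof. exact: posdef_gramD. Qed.

Let mu_p := lebesgue_cv R p.
Let mu_n := lebesgue_cv R n.

Definition latent_mean (z : 'cV[R]_n) : 'cV[R]_p := (invmx M *m (v + X^T *m z))%R.

Let g (z : 'cV[R]_n) (x : 'cV[R]_p) : R := beta_given_z_pdf X Q v z x.
Let w (beta : 'cV[R]_p) (z : 'cV[R]_n) : R := z_given_beta_pdf X y beta z.

(** The transition operator on functions, [da_step], factors through the latent vector, because the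
    two draws call for different couplings. *)
Definition da_mean (f : 'cV[R]_p -> \bar R) (z : 'cV[R]_n) : \bar R :=
  \int[mu_p]_x ((g z x)%:E * f x).

Definition da_step (f : 'cV[R]_p -> \bar R) (beta : 'cV[R]_p) : \bar R :=
  \int[mu_n]_z ((w beta z)%:E * da_mean f z).

Lemma measurable_latent_mean : measurable_fun setT latent_mean.
Proof.
apply: measurable_fun_mulmx => //; apply: measurable_fun_addmx => //.
exact: measurable_fun_mulmx.
Qed.

Lemma measurable_beta_given_z :
  measurable_fun setT (fun zx : 'cV[R]_n * 'cV[R]_p => (g zx.1 zx.2)%:E).
Proof.
apply/measurable_EFinP; apply: measurable_mvnormal_pdf => //.
by apply: (measurableT_comp measurable_latent_mean); exact: measurable_fst.
Qed.

Lemma measurable_beta_given_z_r z : measurable_fun setT (fun x => (g z x)%:E).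
Proof. exact: (measurableT_comp measurable_beta_given_z (measurable_pair1 z)). Qed.

Lemma beta_given_z_ge0 z x : 0 <= (g z x)%:E.
Proof. by rewrite lee_fin; exact: mvnormal_pdf_ge0. Qed.

Lemma measurable_z_given_beta :
  measurable_fun setT (fun bz : 'cV[R]_p * 'cV[R]_n => (w bz.1 bz.2)%:E).
Proof.
apply/measurable_EFinP.
apply: (measurable_trunc_prod2 (f := fun bz : 'cV[R]_p * 'cV[R]_n => X *m bz.1)) => //.
exact: measurable_fun_mulmx.
Qed.

Lemma measurable_z_given_beta_r beta : measurable_fun setT (fun z => (w beta z)%:E).
Proof. exact: (measurableT_comp measurable_z_given_beta (measurable_pair1 beta)). Qed.

Lemma z_given_beta_ge0 beta z : 0 <= (w beta z)%:E.
Proof. by rewrite lee_fin; exact: (trunc_prod_ge0 (X *m beta)). Qed.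

Lemma integral_beta_given_z z : \int[mu_p]_x (g z x)%:E = 1.
Proof. exact: integral_mvnormal_pdf. Qed.

Lemma integral_z_given_beta beta : \int[mu_n]_z (w beta z)%:E = 1.
Proof. exact: (integral_trunc_prod (X *m beta)). Qed.

Section nonneg_fun.
Context (f : 'cV[R]_p -> \bar R).
Hypothesis mf : measurable_fun setT f.
Hypothesis f0 : forall x, 0 <= f x.

Lemma da_mean_ge0 z : 0 <= da_mean f z.
Proof. by apply: integral_ge0 => x _; rewrite mule_ge0// beta_given_z_ge0. Qed.

Lemma measurable_da_mean : measurable_fun setT (da_mean f).
Proof.
apply: (measurable_fun_fubini_tonelli_F
  (fun zx : 'cV[R]_n * 'cV[R]_p => (g zx.1 zx.2)%:E * f zx.2)).
  apply: emeasurable_funM; first exact: measurable_beta_given_z.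
  by apply: (measurableT_comp mf); exact: measurable_snd.
by move=> zx; rewrite mule_ge0// beta_given_z_ge0.
Qed.

Lemma da_step_ge0 beta : 0 <= da_step f beta.
Proof.
apply: integral_ge0 => x _; rewrite mule_ge0 ?z_given_beta_ge0//.
exact: da_mean_ge0.
Qed.

Lemma measurable_da_step : measurable_fun setT (da_step f).
Proof.
apply: (measurable_fun_fubini_tonelli_F
  (fun bz : 'cV[R]_p * 'cV[R]_n => (w bz.1 bz.2)%:E * da_mean f bz.2)).
  apply: emeasurable_funM; first exact: measurable_z_given_beta.
  by apply: (measurableT_comp measurable_da_mean); exact: measurable_snd.
by move=> bz; rewrite mule_ge0 ?z_given_beta_ge0// da_mean_ge0.
Qed.

End nonneg_fun.

Lemma da_mean1 z : da_mean (fun=> 1) z = 1.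
Proof. by rewrite /da_mean; under eq_integral do rewrite mule1; exact: integral_beta_given_z. Qed.

Lemma da_step1 beta : da_step (fun=> 1) beta = 1.
Proof.
rewrite /da_step; under eq_integral do rewrite da_mean1 mule1.
exact: integral_z_given_beta.
Qed.

Lemma da_step_le f h : measurable_fun setT f -> measurable_fun setT h ->
  (forall x, 0 <= f x) -> (forall x, f x <= h x) ->
  forall beta, da_step f beta <= da_step h beta.
Proof.
move=> mf mh f0 fh beta; have h0 x : 0 <= h x by exact: le_trans (fh x).
apply: ge0_le_integral => //.
- by move=> z _; rewrite mule_ge0 ?z_given_beta_ge0// da_mean_ge0.
- apply: emeasurable_funM; first exact: measurable_z_given_beta_r.
  exact: measurable_da_mean.
- apply: emeasurable_funM; first exact: measurable_z_given_beta_r.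
  exact: measurable_da_mean.
- move=> z _; apply: lee_wpmul2l; first exact: z_given_beta_ge0.
  apply: ge0_le_integral => //.
  + by move=> x _; rewrite mule_ge0// beta_given_z_ge0.
  + by apply: emeasurable_funM => //; exact: measurable_beta_given_z_r.
  + by apply: emeasurable_funM => //; exact: measurable_beta_given_z_r.
  + by move=> x _; apply: lee_wpmul2l => //; exact: beta_given_z_ge0.
Qed.

Lemma z_given_beta_out beta z : ~ latent_space y z -> w beta z = 0%R.
Proof.
move=> yz; have [i yzi] : exists i, ~ half_line (y i) (z i ord0).
  by apply: contrapT => h; apply: yz => i; apply: contrapT => hi; apply: h; exists i.
rewrite /w /z_given_beta_pdf (bigD1 i)//= /truncated_normal_pdf.
by rewrite indicE memNset// mulr0 !mul0r.
Qed.

Lemma acda_densityE beta x :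
  acda_density X y Q v beta x = \int[mu_n]_z ((g z x)%:E * (w beta z)%:E).
Proof.
rewrite /acda_density integral_mkcond; apply: eq_integral => z _.
rewrite /patch; case: ifPn => [_|]; first by rewrite EFinM.
by rewrite notin_setE => /z_given_beta_out ->; rewrite mule0.
Qed.

Lemma acda_density_ge0 beta x : 0 <= acda_density X y Q v beta x.
Proof.
rewrite acda_densityE; apply: integral_ge0 => z _.
by rewrite mule_ge0 ?beta_given_z_ge0 ?z_given_beta_ge0.
Qed.

Let measurable_joint beta (f : 'cV[R]_p -> \bar R) : measurable_fun setT f ->
  measurable_fun setT (fun zx : 'cV[R]_n * 'cV[R]_p =>
    (w beta zx.1)%:E * ((g zx.1 zx.2)%:E * f zx.2)).
Proof.
move=> mf; apply: emeasurable_funM.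
  by apply: (measurableT_comp (measurable_z_given_beta_r beta)); exact: measurable_fst.
apply: emeasurable_funM; first exact: measurable_beta_given_z.
by apply: (measurableT_comp mf); exact: measurable_snd.
Qed.

Lemma measurable_acda_density beta : measurable_fun setT (acda_density X y Q v beta).
Proof.
rewrite (_ : acda_density _ _ _ _ _ = fun x => \int[mu_n]_z
    ((w beta z)%:E * ((g z x)%:E * 1))).
  apply: (measurable_fun_fubini_tonelli_G
    (fun zx : 'cV[R]_n * 'cV[R]_p => (w beta zx.1)%:E * ((g zx.1 zx.2)%:E * 1))).
    exact: (measurable_joint _ (f := fun=> 1)).
  by move=> zx; rewrite mule1 mule_ge0 ?beta_given_z_ge0 ?z_given_beta_ge0.
apply/funext => x; rewrite acda_densityE; apply: eq_integral => z _.
by rewrite mule1 muleC.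
Qed.

(** The Gaussian density is bounded by its normalizing constant, uniformly in [z]. Finiteness is
    what [integral_density] asks of the kernel. *)
Lemma acda_density_fin_num beta x : acda_density X y Q v beta x \is a fin_num.
Proof.
rewrite ge0_fin_numE ?acda_density_ge0// acda_densityE.
apply: (@le_lt_trans _ _ (\int[mu_n]_z ((gauss_cst M)%:E * (w beta z)%:E))).
  apply: ge0_le_integral => //.
  - by move=> z _; rewrite mule_ge0 ?beta_given_z_ge0 ?z_given_beta_ge0.
  - apply: emeasurable_funM; last exact: measurable_z_given_beta_r.
    exact: (measurableT_comp measurable_beta_given_z (measurable_pair2 x)).
  - by apply: emeasurable_funM => //; exact: measurable_z_given_beta_r.
  - move=> z _; apply: lee_wpmul2r; first exact: z_given_beta_ge0.
    rewrite lee_fin /g /beta_given_z_pdf -/M mvnormal_pdfE.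
    rewrite ler_piMr ?(ltW (gauss_cst_gt0 dM))// -expR0 ler_expR.
    rewrite mulNr oppr_le0 divr_ge0//; exact: sqform_posdef_ge0.
rewrite ge0_integralZl_EFin//.
- by rewrite integral_z_given_beta mule1 ltry.
- by move=> z _; exact: z_given_beta_ge0.
- exact: measurable_z_given_beta_r.
- exact/ltW/gauss_cst_gt0.
Qed.

Lemma integral_acda_density beta f : measurable_fun setT f -> (forall x, 0 <= f x) ->
  \int[mu_p]_x (f x * acda_density X y Q v beta x) = da_step f beta.
Proof.
move=> mf f0.
transitivity (\int[mu_p]_x \int[mu_n]_z ((w beta z)%:E * ((g z x)%:E * f x))).
  apply: eq_integral => x _; rewrite acda_densityE -ge0_integralZl//.
  - by apply: eq_integral => z _; rewrite [RHS]muleC (muleC (g z x)%:E (f x)) muleA.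
  - apply: emeasurable_funM; last exact: measurable_z_given_beta_r.
    exact: (measurableT_comp measurable_beta_given_z (measurable_pair2 x)).
  - by move=> z _; rewrite mule_ge0 ?beta_given_z_ge0 ?z_given_beta_ge0.
rewrite -(fubini_tonelli (fun zx : 'cV[R]_n * 'cV[R]_p =>
    (w beta zx.1)%:E * ((g zx.1 zx.2)%:E * f zx.2)))/=.
- apply: eq_integral => z _; rewrite ge0_integralZl_EFin//.
  + by move=> x _; rewrite mule_ge0// beta_given_z_ge0.
  + by apply: emeasurable_funM => //; exact: measurable_beta_given_z_r.
  + by rewrite -lee_fin z_given_beta_ge0.
- exact: measurable_joint.
- by move=> zx; rewrite !mule_ge0 ?beta_given_z_ge0 ?z_given_beta_ge0.
Qed.

Lemma integral_acda_kernel beta f : measurable_fun setT f -> (forall x, 0 <= f x) ->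
  \int[acda_kernel X y Q v beta]_x f x = da_step f beta.
Proof.
move=> mf f0; rewrite -integral_acda_density//.
exact: (integral_density mu_p (measurable_acda_density beta) (acda_density_ge0 beta)
  (acda_density_fin_num beta) mf f0).
Qed.

Lemma acda_kernel_indic beta A : measurable A ->
  acda_kernel X y Q v beta A = da_step (fun x => (\1_A x)%:E) beta.
Proof.
move=> mA; rewrite -integral_acda_density.
- rewrite /acda_kernel integral_mkcond; apply: eq_integral => x _.
  by rewrite epatch_indic muleC.
- by apply/measurable_EFinP; exact: measurable_indic.
- by move=> x; rewrite lee_fin.
Qed.

End da_step.

(** * Contraction of Lipschitz constants by one step *)

Section contraction.
Context (R : realType) (n p : nat) (X : 'M[R]_(n, p)) (y : 'I_n -> bool).
Context (Q : 'M[R]_p) (v : 'cV[R]_p).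
Hypothesis dQ : sym_posdef Q.

Let M := (X^T *m X + Q)%R.
Let dM : sym_posdef M. Proof. exact: posdef_gramD. Qed.

Definition post_norm (u : 'cV[R]_p) : R := Num.sqrt (sqform M u).

Local Notation N := post_norm.
Local Notation mz := (latent_mean X Q v).
Local Notation da_mean := (da_mean X Q v).
Local Notation da_step := (da_step X y Q v).

Lemma post_norm_ge0 u : 0 <= N u. Proof. exact: sqrtr_ge0. Qed.

Lemma post_normC u w : N (u - w) = N (w - u).
Proof. by rewrite /post_norm -sqformN opprB. Qed.

Lemma measurable_post_norm d (T : measurableType d) (f : T -> 'cV[R]_p) :
  measurable_fun setT f -> measurable_fun setT (fun x => N (f x)).
Proof.
move=> mf; rewrite (_ : (fun x => _) = fun x => sqform M (f x) `^ (2^-1)).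
  exact: (measurableT_comp (measurable_powR 2^-1) (measurable_fun_sqform M mf)).
apply/funext => x; rewrite /post_norm powR12_sqrt//; exact: sqform_posdef_ge0.
Qed.

Lemma latent_meanB z z' : mz z - mz z' = invmx M *m X^T *m (z - z').
Proof.
rewrite /latent_mean -/M !mulmxDr !mulmxA mulmxN.
by rewrite opprD addrACA subrr add0r.
Qed.

(** The draw is its mean plus a noise whose law is free of [z]. Using the same noise for two latent
    vectors reduces their comparison to that of the means. *)
Lemma da_mean_shiftE (f : 'cV[R]_p -> \bar R) z : measurable_fun setT f -> (forall x, 0 <= f x)%E ->
  da_mean f z = (\int[lebesgue_cv R p]_x
    ((mvnormal_pdf 0 (invmx M) x)%:E * f (x + mz z)%R))%E.
Proof.
move=> mf f0; rewrite /da_mean.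
rewrite -(integral_cv_translation
  (f := fun x => ((beta_given_z_pdf X Q v z x)%:E * f x)%E) (mz z)).
- apply: eq_integral => x _; congr (_%:E * _)%E.
  by rewrite /beta_given_z_pdf -/M -/(mz z) !mvnormal_pdfE addrK subr0.
- by apply: emeasurable_funM => //; exact: measurable_beta_given_z_r.
- by move=> x; rewrite mule_ge0// beta_given_z_ge0.
Qed.

Lemma da_mean_lip (f : 'cV[R]_p -> \bar R) (c : R) z z' : 0 <= c ->
  measurable_fun setT f -> (forall x, 0 <= f x)%E ->
  (forall x x', f x <= f x' + (c * N (x - x'))%:E)%E ->
  (da_mean f z <= da_mean f z' + (c * N (mz z - mz z'))%:E)%E.
Proof.
move=> c0 mf f0 fl; rewrite !da_mean_shiftE//.
set k := c * _; have k0 : 0 <= k by rewrite mulr_ge0// post_norm_ge0.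
pose h x := mvnormal_pdf 0 (invmx M) x.
have mh : measurable_fun setT (fun x => (h x)%:E).
  by apply/measurable_EFinP; exact: measurable_mvnormal_pdf.
have h0 x : (0 <= (h x)%:E)%E by rewrite lee_fin mvnormal_pdf_ge0.
have mt a : measurable_fun setT (fun x : 'cV[R]_p => f (x + a)).
  by apply: (measurableT_comp mf); exact: measurable_fun_addmx.
have mhf a : measurable_fun setT (fun x : 'cV[R]_p => (h x)%:E * f (x + a)%R)%E.
  exact: emeasurable_funM.
have -> : (k%:E = \int[lebesgue_cv R p]_x ((h x)%:E * k%:E))%E.
  by rewrite ge0_integralZr// integral_mvnormal_pdf// mul1e.
rewrite -ge0_integralD//; last 3 first.
- by move=> x _; rewrite mule_ge0.
- by move=> x _; rewrite mule_ge0.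
- exact: emeasurable_funM.
apply: ge0_le_integral => //.
- by move=> x _; rewrite mule_ge0.
- apply: emeasurable_funD; first exact: (mhf (mz z')).
  exact: emeasurable_funM.
- move=> x _; rewrite -ge0_muleDr//; apply: lee_wpmul2l => //.
  apply: le_trans (fl _ (x + mz z')) _; apply: leeD => //; rewrite lee_fin /k.
  by rewrite opprD addrACA subrr add0r.
Qed.

(** Indicators are in general not Lipschitz, but averaging over the Gaussian draw makes them so as
    functions of the mean, by the total variation bound. The factor [1] is the constant [c] of
    [latent_step_lip]. *)
Lemma da_mean_indic_lip (A : set 'cV[R]_p) z z' : measurable A ->
  (da_mean (fun x => (\1_A x)%:E) z <=
   da_mean (fun x => (\1_A x)%:E) z' + (1 * N (mz z - mz z'))%:E)%E.
Proof.
have E u : measurable A -> da_mean (fun x => (\1_A x)%:E) u =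
    (\int[lebesgue_cv R p]_(x in A) (mvnormal_pdf (mz u) (invmx M) x)%:E)%E.
  move=> mA; rewrite [RHS]integral_mkcond; apply: eq_integral => x _.
  by rewrite epatch_indic.
by move=> mA; rewrite !E// mul1r; exact: mvnormal_tv_le.
Qed.

Section rate.
Context (rho : R).
Hypothesis rho0 : 0 <= rho.
Hypothesis rhoX : forall u, dotcv (X *m u) (X *m u) <= rho * sqform M u.

Lemma latent_mean_contraction beta beta' (z z' : 'cV[R]_n) :
  (forall i, `|z i ord0 - z' i ord0| <=
             `|(X *m beta) i ord0 - (X *m beta') i ord0|) ->
  N (mz z - mz z') <= rho * N (beta - beta').
Proof.
move=> zz'; rewrite latent_meanB /post_norm.
have -> : rho * Num.sqrt (sqform M (beta - beta')) =
    Num.sqrt (rho ^+ 2 * sqform M (beta - beta')).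
  by rewrite sqrtrM ?sqr_ge0// sqrtr_sqr ger0_norm.
apply: ler_wsqrtr; apply: gain_contraction => //.
apply: ler_sum => i _; rewrite -!expr2 -ler_sqrt ?sqr_ge0// !sqrtr_sqr.
by have := zz' i; rewrite mulmxBr !mxE.
Qed.

(** The latent draw provides the factor [rho]. Stated for a function [h] of [z], the bound serves
    both averages of Lipschitz functions and averages of indicators. *)
Lemma latent_step_lip (h : 'cV[R]_n -> \bar R) (c : R) beta beta' : 0 <= c ->
  measurable_fun setT h -> (forall z, 0 <= h z)%E ->
  (forall z z', h z <= h z' + (c * N (mz z - mz z'))%:E)%E ->
  (\int[lebesgue_cv R n]_z ((z_given_beta_pdf X y beta z)%:E * h z) <=
   \int[lebesgue_cv R n]_z ((z_given_beta_pdf X y beta' z)%:E * h z) +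
   (rho * c * N (beta - beta'))%:E)%E.
Proof.
move=> c0 mh h0 hl.
apply: (@trunc_prod_coupling _ _ (X *m beta) (X *m beta') y _ h h) => //.
  by rewrite !mulr_ge0// post_norm_ge0.
move=> z z' zz'; apply: le_trans (hl z z') _; apply: leeD => //.
rewrite lee_fin mulrAC [leRHS]mulrC; apply: ler_wpM2l => //.
exact: latent_mean_contraction.
Qed.

Lemma da_step_lip (f : 'cV[R]_p -> \bar R) (c : R) : 0 <= c ->
  measurable_fun setT f -> (forall x, 0 <= f x)%E ->
  (forall x x', f x <= f x' + (c * N (x - x'))%:E)%E ->
  forall x x', (da_step f x <= da_step f x' + (rho * c * N (x - x'))%:E)%E.
Proof.
move=> c0 mf f0 fl x x'; apply: latent_step_lip => //.
- exact: measurable_da_mean.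
- by move=> z; exact: da_mean_ge0.
- by move=> z z'; exact: da_mean_lip.
Qed.

Lemma da_step_indic_lip (A : set 'cV[R]_p) x x' : measurable A ->
  (da_step (fun x => (\1_A x)%:E) x <=
   da_step (fun x => (\1_A x)%:E) x' + (rho * N (x - x'))%:E)%E.
Proof.
move=> mA; rewrite -[rho]mulr1.
have m1 : measurable_fun setT (fun x : 'cV[R]_p => (\1_A x)%:E : \bar R).
  by apply/measurable_EFinP; exact: measurable_indic.
apply: latent_step_lip => //.
- exact: measurable_da_mean.
- by move=> z; apply: da_mean_ge0 => t; rewrite lee_fin.
- by move=> z z'; exact: da_mean_indic_lip.
Qed.

End rate.
End contraction.

(** * The posterior distribution *)

Section probit_likelihood.
Context (R : realType).

Lemma integral_reflection (f : R -> \bar R) : measurable_fun setT f ->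
  (forall x, 0 <= f x)%E ->
  (\int[lebesgue_measure]_x f (- x)%R = \int[lebesgue_measure]_x f x)%E.
Proof.
move=> mf f0; have mN : measurable_fun setT (fun x : measurableTypeR R => - x : measurableTypeR R).
  by apply: measurableT_comp.
have := @ge0_integral_pushforward _ _ _ _ R _ mN lebesgue_measure setT f measurableT mf (fun y _ => f0 y).
rewrite preimage_setT => <-.
by apply: eq_measure_integral => A mA _; exact: lebesgue_measureN.
Qed.

(** After a shift to mean zero and a reflection the event becomes []-oo, m[]; its missing endpoint
    is a null set. *)
Lemma nprob_upper (m : R) : nprob m `]0, +oo[%classic = std_normal_cdf m.
Proof.
rewrite -[m in LHS]add0r nprob_shift; last exact: measurable_itv.
rewrite (_ : [set _ | _] = `]- m, +oo[%classic); last first.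
  by apply/seteqP; split=> x /=; rewrite !in_itv/= !andbT -ltrBlDr sub0r.
rewrite /nprob normal_prob_indic; last exact: measurable_itv.
rewrite -integral_reflection; last 2 first.
- apply/measurable_EFinP; apply: measurable_funM; first exact: measurable_normal_pdf.
  by apply: measurable_indic; exact: measurable_itv.
- by move=> x; rewrite lee_fin mulr_ge0// normal_pdf_ge0.
rewrite /std_normal_cdf; congr fine.
transitivity (\int[lebesgue_measure]_(x in `]-oo, m[) (normal_pdf 0 1 x)%:E)%E.
  rewrite [RHS]integral_mkcond; apply: eq_integral => x _.
  rewrite epatch_indic -EFinM !normal_pdf1E !subr0 sqrrN; congr (_ * _)%:E.
  rewrite !indicE; congr (_%:R); congr nat_of_bool; apply/idP/idP; rewrite !inE/= !in_itv/= ?andbT;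
    by rewrite ltrN2.
by apply: integral_itv_bndo_bndc; apply: measurable_funTS; apply/measurable_EFinP; exact: measurable_normal_pdf.
Qed.

Lemma nprob_half_line (m : R) (b : bool) :
  nprob m (half_line b) = std_normal_cdf m ^+ b * (1 - std_normal_cdf m) ^+ (1 - b).
Proof.
case: b => /=; first by rewrite expr1 expr0 mulr1 nprob_upper.
rewrite expr0 mul1r expr1 -nprob_upper -nprob_setC; last exact: measurable_itv.
by congr nprob; rewrite setCitvr.
Qed.

Section likelihood.
Context (n p : nat) (X : 'M[R]_(n, p)) (y : 'I_n -> bool).

Lemma probit_likelihoodE beta : probit_likelihood X y beta =
  \prod_(i < n) nprob ((X *m beta) i ord0) (half_line (y i)).
Proof. by apply: eq_bigr => i _; rewrite nprob_half_line. Qed.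

Lemma probit_likelihood_gt0 beta : 0 < probit_likelihood X y beta.
Proof.
by rewrite probit_likelihoodE; apply: prodr_gt0 => i _; exact: nprob_half_line_gt0.
Qed.

Lemma probit_likelihood_le1 beta : probit_likelihood X y beta <= 1.
Proof.
rewrite probit_likelihoodE; apply: prodr_ile1 => i _.
by rewrite nprob_ge0/= nprob_le1//; exact: measurable_half_line.
Qed.

Lemma measurable_probit_likelihood : measurable_fun setT (probit_likelihood X y).
Proof.
rewrite (_ : probit_likelihood X y = fun beta =>
    \prod_(i < n) nprob ((X *m beta) i ord0) (half_line (y i))); last first.
  by apply/funext => beta; exact: probit_likelihoodE.
apply: measurable_prod => i _.
apply: (measurableT_comp (measurable_nprob (measurable_half_line _))).
by apply: measurable_fun_entry; exact: measurable_fun_mulmx.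
Qed.

Lemma likelihood_latentE beta z :
  probit_likelihood X y beta * z_given_beta_pdf X y beta z =
  \prod_(i < n) (normal_pdf ((X *m beta) i ord0) 1 (z i ord0) *
                 \1_(half_line (y i)) (z i ord0)).
Proof.
rewrite probit_likelihoodE -big_split/=; apply: eq_bigr => i _.
by rewrite /truncated_normal_pdf mulrCA divff ?mulr1// gt_eqF// nprob_half_line_gt0.
Qed.

End likelihood.
End probit_likelihood.

(** * Invariance of the posterior *)

Section posterior_invariance.
Context (R : realType) (n p : nat) (X : 'M[R]_(n, p)) (y : 'I_n -> bool).
Context (Q : 'M[R]_p) (v : 'cV[R]_p).
Hypothesis dQ : sym_posdef Q.

Let M := (X^T *m X + Q)%R.
Let dM : sym_posdef M. Proof. exact: posdef_gramD. Qed.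

Local Notation mz := (latent_mean X Q v).
Local Notation da_mean := (da_mean X Q v).
Local Notation da_step := (da_step X y Q v).

Lemma bil_invmx k (P : 'M[R]_k) (u w : 'cV[R]_k) : sym_posdef P ->
  bil P u (invmx P *m w) = dotcv u w.
Proof.
by move=> dP; rewrite /bil dotcvE -mulmxA mulKVmx// posdef_unitmx.
Qed.

Lemma dotcvDr k (u w w' : 'cV[R]_k) : dotcv u (w + w') = dotcv u w + dotcv u w'.
Proof. by rewrite !dotcvE mulmxDr mxE. Qed.

Lemma dotcv_mul_tr (u : 'cV[R]_p) (z : 'cV[R]_n) : dotcv u (X^T *m z) = dotcv z (X *m u).
Proof.
rewrite !dotcvE mulmxA -trmx_mul; transitivity (((z^T *m (X *m u))^T) ord0 ord0).
  by rewrite [in RHS]trmx_mul trmxK.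
by rewrite mxE.
Qed.

Lemma dotcvB_sqr (u w : 'cV[R]_n) :
  dotcv (u - w) (u - w) = dotcv u u - 2 * dotcv u w + dotcv w w.
Proof.
rewrite /dotcv mulr_sumr -sumrB -big_split/=; apply: eq_bigr => i _.
by rewrite !mxE; ring.
Qed.

Definition latent_energy (z : 'cV[R]_n) : R :=
  sqform Q (invmx Q *m v) + dotcv z z - sqform M (mz z).

(** Conjugacy: with [z] fixed, the left side is quadratic in [beta] with matrix [M], and its
    minimizer [latent_mean z] solves the normal equations. The remainder [latent_energy z] is free
    of [beta]. *)
Lemma complete_square beta z :
  sqform Q (beta - invmx Q *m v) + dotcv (z - X *m beta) (z - X *m beta) =
  sqform M (beta - mz z) + latent_energy z.
Proof.
rewrite sqformB ?dQ.1// bil_invmx// sqformB ?dM.1// bil_invmx//.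
rewrite dotcvDr dotcv_mul_tr dotcvB_sqr /latent_energy [sqform M beta]sqformD sqform_gram.
move: (sqform _ _) (sqform _ _) (sqform _ _) (dotcv _ _) (dotcv _ _) (dotcv _ _) (dotcv _ _).
by move=> *; ring.
Qed.

Lemma measurable_prior_pdf : measurable_fun setT (prior_pdf Q v).
Proof. exact: measurable_mvnormal_pdf. Qed.

Lemma prior_pdf_gt0 beta : 0 < prior_pdf Q v beta.
Proof. by rewrite /prior_pdf mvnormal_pdfE mulr_gt0 ?expR_gt0// gauss_cst_gt0. Qed.

Definition posterior_weight beta : R := prior_pdf Q v beta * probit_likelihood X y beta.

Lemma posterior_weight_gt0 beta : 0 < posterior_weight beta.
Proof. by rewrite mulr_gt0 ?prior_pdf_gt0 ?probit_likelihood_gt0. Qed.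

Lemma measurable_posterior_weight : measurable_fun setT posterior_weight.
Proof.
apply: measurable_funM; first exact: measurable_prior_pdf.
exact: measurable_probit_likelihood.
Qed.

(* [D] need not be measurable: only its products with the conditional density
   of beta given z are integrated. *)
Lemma joint_factor : exists D : 'cV[R]_n -> R, (forall z, 0 <= D z) /\
  forall beta z, posterior_weight beta * z_given_beta_pdf X y beta z =
                 D z * beta_given_z_pdf X Q v z beta.
Proof.
pose ind (z : 'cV[R]_n) : R := \prod_(i < n) \1_(half_line (y i)) (z i ord0).
have pk0 : 0 <= normal_peak (1 : R) by exact: normal_peak_ge0.
have gM := gauss_cst_gt0 dM; have gQ := gauss_cst_gt0 dQ.
exists (fun z => gauss_cst Q * normal_peak 1 ^+ n * expR (- latent_energy z / 2)
  / gauss_cst M * ind z).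
split=> [z|beta z].
  rewrite !mulr_ge0 ?expR_ge0 ?exprn_ge0 ?invr_ge0 ?(ltW gM) ?(ltW gQ)//.
  by apply: prodr_ge0 => i _; rewrite indicE.
rewrite /posterior_weight -mulrA likelihood_latentE big_split/= -/(ind z).
have -> : \prod_(i < n) normal_pdf ((X *m beta) i ord0) 1 (z i ord0) =
    normal_peak 1 ^+ n * expR (- dotcv (z - X *m beta) (z - X *m beta) / 2).
  under eq_bigr do rewrite normal_pdf1E.
  rewrite big_split/= prodr_const card_ord -expR_sum; congr (_ * expR _).
  rewrite -mulr_suml -sumrN; congr (_ / _); apply: eq_bigr => i _.
  by rewrite !mxE expr2.
rewrite /prior_pdf /beta_given_z_pdf -/M -/(mz z) !mvnormal_pdfE.
set a := sqform Q _; set d := dotcv _ _; set b := sqform M _; set e := latent_energy z.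
have h : a + d = b + e by exact: complete_square.
(* The exponent [a] is eliminated through [h]; the factor [expR (d / 2)] that this creates cancels
   against the latent density. *)
have -> : expR (- a / 2) = expR (- e / 2) * expR (- b / 2) * expR (d / 2).
  rewrite -!expRD; congr expR.
  have -> : a = b + e - d by rewrite -h addrK.
  by field.
have -> : expR (- d / 2) = (expR (d / 2))^-1 by rewrite mulNr expRN.
by field; rewrite !gt_eqF ?expR_gt0.
Qed.

(** [J] is an unnormalized joint density of state and latent vector whose conditional law of the
    state given [z] is the Gaussian one. A step redraws the state from this conditional law, which
    preserves the joint law. *)
Lemma posterior_weight_invariant (f : 'cV[R]_p -> \bar R) :
  measurable_fun setT f -> (forall x, 0 <= f x)%E ->
  (\int[lebesgue_cv R p]_x ((posterior_weight x)%:E * da_step f x) =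
   \int[lebesgue_cv R p]_x ((posterior_weight x)%:E * f x))%E.
Proof.
move=> mf f0; have [D [D0 DE]] := joint_factor.
have W0 x : (0 <= (posterior_weight x)%:E)%E by rewrite lee_fin ltW// posterior_weight_gt0.
have mW : measurable_fun setT (fun x => (posterior_weight x)%:E).
  by apply/measurable_EFinP; exact: measurable_posterior_weight.
have mF := measurable_da_mean X Q v mf f0.
have F0 := da_mean_ge0 X Q v f0.
pose J (xz : 'cV[R]_p * 'cV[R]_n) : \bar R :=
  ((posterior_weight xz.1)%:E * (z_given_beta_pdf X y xz.1 xz.2)%:E)%E.
have J0 xz : (0 <= J xz)%E by rewrite mule_ge0// z_given_beta_ge0.
have mJ : measurable_fun setT J.
  apply: emeasurable_funM; last exact: measurable_z_given_beta.
  by apply: (measurableT_comp mW); exact: measurable_fst.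
have JE x z : J (x, z) = ((D z)%:E * (beta_given_z_pdf X Q v z x)%:E)%E.
  by rewrite /J -!EFinM DE.
transitivity (\int[lebesgue_cv R p]_x \int[lebesgue_cv R n]_z (J (x, z) * da_mean f z))%E.
  apply: eq_integral => x _; rewrite -ge0_integralZl_EFin//.
  - by apply: eq_integral => z _; rewrite muleA.
  - by move=> z _; rewrite mule_ge0// z_given_beta_ge0.
  - by apply: emeasurable_funM => //; exact: measurable_z_given_beta_r.
  - exact/ltW/posterior_weight_gt0.
rewrite (fubini_tonelli (fun xz => J xz * da_mean f xz.2)%E); last 2 first.
- apply: emeasurable_funM; first exact: mJ.
  by apply: (measurableT_comp mF); exact: measurable_snd.
- by move=> xz; apply: mule_ge0; [exact: J0|exact: F0].
transitivity (\int[lebesgue_cv R n]_z \int[lebesgue_cv R p]_x (J (x, z) * f x))%E.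
  apply: eq_integral => z _ /=.
  have mg := measurable_beta_given_z_r X Q v z.
  have g0 := beta_given_z_ge0 X Q v z.
  (* With [z] fixed, [da_mean f z] is a constant, and by [JE] both integrals over [x] take this
     value. *)
  transitivity ((D z)%:E * da_mean f z)%E.
    under eq_integral do rewrite JE.
    rewrite ge0_integralZr//; last 2 first.
    - by apply: emeasurable_funM; [exact: measurable_cst|exact: mg].
    - by move=> x _; apply: mule_ge0; [rewrite lee_fin|exact: g0].
    rewrite ge0_integralZl_EFin//.
    by rewrite integral_beta_given_z// mule1.
  rewrite -ge0_integralZl_EFin//; last 2 first.
  - by move=> x _; apply: mule_ge0; [exact: g0|exact: f0].
  - by apply: emeasurable_funM; [exact: mg|exact: mf].
  by apply: eq_integral => x _; rewrite JE muleA.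
rewrite -(fubini_tonelli (fun xz => J xz * f xz.1)%E); last 2 first.
- apply: emeasurable_funM; first exact: mJ.
  by apply: (measurableT_comp mf); exact: measurable_fst.
- by move=> xz; apply: mule_ge0; [exact: J0|exact: f0].
apply: eq_integral => x _ /=.
have mJx : measurable_fun setT (fun z => J (x, z)).
  exact: (measurableT_comp mJ (measurable_pair1 x)).
rewrite (ge0_integralZr (lebesgue_cv R n) measurableT mJx (fun z _ => J0 (x, z)) (f0 x)).
rewrite /J /= ge0_integralZl_EFin//.
- by rewrite integral_z_given_beta mule1.
- by move=> z _; exact: z_given_beta_ge0.
- exact: measurable_z_given_beta_r.
- exact/ltW/posterior_weight_gt0.
Qed.

End posterior_invariance.

(** * Normalization and first moment of the posterior *)

Section posterior.
Context (R : realType) (n p : nat) (X : 'M[R]_(n, p)) (y : 'I_n -> bool).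
Context (Q : 'M[R]_p) (v : 'cV[R]_p).
Hypothesis dQ : sym_posdef Q.

Let M := (X^T *m X + Q)%R.
Let dM : sym_posdef M. Proof. exact: posdef_gramD. Qed.

Local Notation N := (post_norm X Q).
Local Notation W := (posterior_weight X y Q v).
Local Notation post := (posterior_pdf X y Q v).
Local Notation m := (marginal_likelihood X y Q v).
Local Notation da_step := (da_step X y Q v).

Let mW : measurable_fun setT (fun x => (W x)%:E).
Proof. by apply/measurable_EFinP; exact: measurable_posterior_weight. Qed.

Let W0 x : (0 <= (W x)%:E)%E.
Proof. by rewrite lee_fin ltW// posterior_weight_gt0. Qed.

Lemma posterior_weight_le_prior x : W x <= prior_pdf Q v x.
Proof.
rewrite /posterior_weight ler_piMr ?probit_likelihood_le1//.
exact/ltW/prior_pdf_gt0.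
Qed.

Lemma marginal_likelihood_le1 : (m <= 1)%E.
Proof.
rewrite -(integral_mvnormal_pdf dQ (invmx Q *m v)).
apply: ge0_le_integral => //.
- by move=> x _; exact: W0.
- by apply/measurable_EFinP; exact: measurable_prior_pdf.
- by move=> x _; rewrite lee_fin posterior_weight_le_prior.
Qed.

Lemma marginal_likelihood_gt0 : (0 < m)%E.
Proof.
rewrite lt_neqAle; apply/andP; split; last by apply: integral_ge0 => x _; exact: W0.
apply/eqP => m0.
have : (\int[lebesgue_cv R p]_x `|(W x)%:E| = 0)%E.
  by rewrite [RHS]m0; apply: eq_integral => x _; rewrite gee0_abs// W0.
move=> /(ae_eq_integral_abs (lebesgue_cv R p) measurableT mW) ae0.
(* [W] vanishes nowhere, so its vanishing almost everywhere makes every property hold almost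
   everywhere; a prior density that is almost everywhere zero contradicts its total mass one. *)
have ae1 : ae_eq (lebesgue_cv R p) setT (fun x => (prior_pdf Q v x)%:E) (cst 0%E).
  apply: filterS ae0 => x h Tx; have := h Tx => /= -[W00].
  by have := posterior_weight_gt0 X y v dQ x; rewrite W00 ltxx.
have := integral_mvnormal_pdf dQ (invmx Q *m v).
rewrite (ae_eq_integral (cst 0%E) (fun x => (prior_pdf Q v x)%:E) measurableT _ _ ae1)//.
  by rewrite integral_cst// mul0e => -[] /esym/eqP; rewrite oner_eq0.
by apply/measurable_EFinP; exact: measurable_prior_pdf.
Qed.

Lemma marginal_likelihood_fine : m = (fine m)%:E.
Proof.
rewrite fineK// ge0_fin_numE ?(ltW marginal_likelihood_gt0)//.
exact: le_lt_trans marginal_likelihood_le1 (ltry _).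
Qed.

Lemma fine_marginal_gt0 : 0 < fine m.
Proof. by rewrite -lte_fin -marginal_likelihood_fine marginal_likelihood_gt0. Qed.

Lemma posterior_pdf_ge0 x : (0 <= (post x)%:E)%E.
Proof.
by rewrite lee_fin mulr_ge0 ?invr_ge0 ?(ltW fine_marginal_gt0)// -lee_fin W0.
Qed.

Lemma measurable_posterior_pdf : measurable_fun setT (fun x => (post x)%:E).
Proof.
apply/measurable_EFinP; apply: measurable_funM => //.
exact: measurable_posterior_weight.
Qed.

Lemma integral_posterior_pdfE (f : 'cV[R]_p -> \bar R) :
  measurable_fun setT f -> (forall x, 0 <= f x)%E ->
  (\int[lebesgue_cv R p]_x ((post x)%:E * f x) =
   ((fine m)^-1)%:E * \int[lebesgue_cv R p]_x ((W x)%:E * f x))%E.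
Proof.
move=> mf f0; rewrite -ge0_integralZl_EFin.
- by apply: eq_integral => x _; rewrite muleA -EFinM.
- exact: measurableT.
- by move=> x _; apply: mule_ge0; [exact: W0|exact: f0].
- by apply: emeasurable_funM; [exact: mW|exact: mf].
- by rewrite invr_ge0; exact/ltW/fine_marginal_gt0.
Qed.

Lemma integral_posterior_pdf : (\int[lebesgue_cv R p]_x (post x)%:E = 1)%E.
Proof.
have := @integral_posterior_pdfE (cst 1%E) (measurable_cst _) (fun=> lee01).
under eq_integral do rewrite mule1.
under [in X in _ = X -> _]eq_integral do rewrite mule1.
move=> ->; rewrite -[X in (_ * X)%E]/m [X in (_ * X)%E]marginal_likelihood_fine.
by rewrite -EFinM mulVf// gt_eqF// fine_marginal_gt0.
Qed.

Lemma posterior_invariant (f : 'cV[R]_p -> \bar R) :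
  measurable_fun setT f -> (forall x, 0 <= f x)%E ->
  (\int[lebesgue_cv R p]_x ((post x)%:E * da_step f x) =
   \int[lebesgue_cv R p]_x ((post x)%:E * f x))%E.
Proof.
move=> mf f0; rewrite !integral_posterior_pdfE//.
- by congr (_ * _)%E; exact: posterior_weight_invariant.
- exact: measurable_da_step.
- by move=> x; exact: da_step_ge0.
Qed.

Lemma posteriorE (A : set 'cV[R]_p) : measurable A ->
  posterior X y Q v A = (\int[lebesgue_cv R p]_x ((post x)%:E * (\1_A x)%:E))%E.
Proof.
move=> mA; rewrite /posterior integral_mkcond; apply: eq_integral => x _.
by rewrite epatch_indic.
Qed.

(** The exponent is half of that of the prior density, with opposite sign, so the product with the
    prior is still integrable. *)
Lemma post_norm_exp_bound (beta : 'cV[R]_p) : exists2 K : R, 0 <= K & forall x : 'cV[R]_p,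
  N (beta - x) <= K * expR (sqform Q (x - invmx Q *m v) / 4).
Proof.
have [k k0 hk] := gram_le_posdef X dQ.
set a := invmx Q *m v; pose B := sqform Q (beta - a).
have B0 : 0 <= B by exact: sqform_posdef_ge0.
(* From [N <= 1 + N^2], [N^2 <= (1 + k) (2 B + 2 q)], [1 <= expR (q / 4)] and
   [q <= 4 expR (q / 4)]. *)
exists (1 + 2 * (1 + k) * B + 8 * (1 + k)).
  by rewrite !addr_ge0// !mulr_ge0// addr_ge0.
move=> x; set q := sqform Q (x - a).
have q0 : 0 <= q by exact: sqform_posdef_ge0.
have s0 : 0 <= sqform M (beta - x) by exact: sqform_posdef_ge0.
have sM : sqform M (beta - x) <= (1 + k) * (2 * B + 2 * q).
  have h1 : sqform Q (beta - x) <= 2 * B + 2 * q.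
    rewrite (_ : beta - x = (beta - a) - (x - a)); first exact: sqformB_le.
    by rewrite opprB addrA subrK.
  have h2 := hk (beta - x); rewrite /M sqformD.
  by apply: (@le_trans _ _ ((1 + k) * sqform Q (beta - x))); [lra|rewrite ler_wpM2l// addr_ge0].
have sq : N (beta - x) <= 1 + sqform M (beta - x).
  rewrite /post_norm -/M; set s := sqform M _ in s0 *.
  rewrite -[leRHS]ger0_norm ?addr_ge0// -sqrtr_sqr ler_wsqrtr// sqrrD expr1n; nra.
have e1 : 1 <= expR (q / 4) by rewrite -expR0 ler_expR divr_ge0.
have e2 : q / 4 <= expR (q / 4) by have := expR_ge1Dx (q / 4); lra.
apply: (le_trans sq); apply: (@le_trans _ _ (1 + (1 + k) * (2 * B + 2 * q))).
  by rewrite lerD2l.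
have h3 : (1 + 2 * (1 + k) * B) <= (1 + 2 * (1 + k) * B) * expR (q / 4).
  by rewrite ler_peMr// addr_ge0// !mulr_ge0// addr_ge0.
have h4 : 8 * (1 + k) * (q / 4) <= 8 * (1 + k) * expR (q / 4).
  by rewrite ler_wpM2l// mulr_ge0// addr_ge0.
rewrite mulrDl; lra.
Qed.

Lemma measurable_post_normB (beta : 'cV[R]_p) :
  measurable_fun setT (fun x : 'cV[R]_p => (N (beta - x))%:E).
Proof.
apply/measurable_EFinP; apply: (measurable_post_norm X dQ).
exact: measurable_fun_submx.
Qed.

Lemma posterior_moment_lty (beta : 'cV[R]_p) :
  (\int[lebesgue_cv R p]_x ((post x)%:E * (N (beta - x))%:E) < +oo)%E.
Proof.
have [K K0 hK] := post_norm_exp_bound beta.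
set a := invmx Q *m v in hK.
(* The prior exponent [- q / 2] absorbs the growth [q / 4]; what remains is a Gaussian with
   precision [Q / 2]. *)
have dQ2 : sym_posdef (2^-1 *: Q) by apply: posdef_scale.
pose c := (fine m)^-1 * (gauss_cst Q * K).
have c0 : 0 <= c.
  apply: mulr_ge0; first by rewrite invr_ge0; exact/ltW/fine_marginal_gt0.
  by apply: mulr_ge0 K0; exact: ltW (gauss_cst_gt0 dQ).
have me : measurable_fun setT (fun x : 'cV[R]_p => (expR (- sqform (2^-1 *: Q) (x - a) / 2))%:E).
  apply/measurable_EFinP; apply: measurable_expR_sqform.
  exact: measurable_fun_submx.
apply: (@le_lt_trans _ _ (\int[lebesgue_cv R p]_x
    (c%:E * (expR (- sqform (2^-1 *: Q) (x - a) / 2))%:E))%E).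
  apply: ge0_le_integral.
  - exact: measurableT.
  - move=> x _; apply: mule_ge0; first exact: posterior_pdf_ge0.
    by rewrite lee_fin; exact: post_norm_ge0.
  - apply: emeasurable_funM; first exact: measurable_posterior_pdf.
    exact: measurable_post_normB.
  - by apply: emeasurable_funM; [exact: measurable_cst|exact: me].
  - move=> x _; rewrite -!EFinM lee_fin /c.
    rewrite -[post x]/((fine m)^-1 * W x) -[leLHS]mulrA -[leRHS]mulrA.
    apply: ler_wpM2l; first by rewrite invr_ge0; exact/ltW/fine_marginal_gt0.
    rewrite -[leRHS]mulrA.
    apply: (@le_trans _ _ (prior_pdf Q v x * (K * expR (sqform Q (x - a) / 4)))).
      apply: ler_pM; [|exact: post_norm_ge0|exact: posterior_weight_le_prior|exact: hK].
      exact/ltW/posterior_weight_gt0.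
    rewrite /prior_pdf mvnormal_pdfE -/a -!mulrA ler_wpM2l//; first exact: ltW (gauss_cst_gt0 dQ).
    rewrite mulrCA ler_wpM2l// -expRD ler_expR sqformZ.
    by set q := sqform _ _; rewrite le_eqVlt; apply/orP; left; apply/eqP; field.
rewrite ge0_integralZl_EFin.
- have [_ ->] := posdef_det_integral_gauss a dQ2.
  by rewrite -EFinM ltry.
- exact: measurableT.
- by move=> x _; rewrite lee_fin expR_ge0.
- exact: me.
- exact: c0.
Qed.

(** One of [h] and [k] will be the constant value of an iterate at [beta], the other the iterate
    itself; exchanging them gives both sides of an absolute value. *)
Lemma posterior_average_le (h k : 'cV[R]_p -> \bar R) (r : R) (beta : 'cV[R]_p) :
  0 <= r ->
  measurable_fun setT h -> (forall x, 0 <= h x)%E ->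
  measurable_fun setT k -> (forall x, 0 <= k x)%E ->
  (forall x, h x <= k x + (r * N (beta - x))%:E)%E ->
  (\int[lebesgue_cv R p]_x ((post x)%:E * h x) <=
   \int[lebesgue_cv R p]_x ((post x)%:E * k x) +
   r%:E * \int[lebesgue_cv R p]_x ((post x)%:E * (N (beta - x))%:E))%E.
Proof.
move=> r0 mh h0 mk k0 hk.
have mp := measurable_posterior_pdf.
have p0 := posterior_pdf_ge0.
have mN := measurable_post_normB beta.
have N0 x : (0 <= (N (beta - x))%:E)%E by rewrite lee_fin; exact: post_norm_ge0.
rewrite -ge0_integralZl_EFin; [|exact: measurableT| |exact: emeasurable_funM|exact: r0]; last first.
  by move=> x _; apply: mule_ge0; [exact: p0|exact: N0].
have mr : measurable_fun setT (fun x => r%:E * ((post x)%:E * (N (beta - x))%:E))%E.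
  by apply: emeasurable_funM; [exact: measurable_cst|exact: emeasurable_funM].
have rp0 x : (0 <= r%:E * ((post x)%:E * (N (beta - x))%:E))%E.
  by apply: mule_ge0; [rewrite lee_fin|apply: mule_ge0; [exact: p0|exact: N0]].
have mpk : measurable_fun setT (fun x => (post x)%:E * k x)%E by exact: emeasurable_funM.
have pk0 x : (0 <= (post x)%:E * k x)%E by apply: mule_ge0; [exact: p0|exact: k0].
rewrite -(ge0_integralD _ measurableT (fun x _ => pk0 x) mpk (fun x _ => rp0 x) mr).
apply: ge0_le_integral.
- exact: measurableT.
- by move=> x _; apply: mule_ge0; [exact: p0|exact: h0].
- exact: emeasurable_funM.
- exact: emeasurable_funD.
- move=> x _; apply: (@le_trans _ _ ((post x)%:E * (k x + (r * N (beta - x))%:E))%E).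
    by apply: lee_wpmul2l; [exact: p0|exact: hk].
  rewrite ge0_muleDr; [|exact: k0|by rewrite lee_fin mulr_ge0// post_norm_ge0].
  by rewrite EFinM muleCA.
Qed.

End posterior.

(** * Geometric ergodicity *)

Section geometric_ergodicity.
Context (R : realType) (n p : nat) (X : 'M[R]_(n, p)) (y : 'I_n -> bool).
Context (Q : 'M[R]_p) (v : 'cV[R]_p).
Hypothesis dQ : sym_posdef Q.

Local Notation N := (post_norm X Q).
Local Notation post := (posterior_pdf X y Q v).
Local Notation K := (acda_kernel X y Q v).

Context (rho : R).
Hypothesis rho0 : 0 <= rho.
Hypothesis rhoX : forall u,
  dotcv (X *m u) (X *m u) <= rho * sqform (X^T *m X + Q) u.

(** Invariant of the induction on the number of steps. The bound by one keeps values finite for the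
    final subtraction; the mean clause is the invariance of the posterior under the iterates, tested
    on one set. *)
Definition lipschitz_mean (r : R) (a : \bar R) (h : 'cV[R]_p -> \bar R) : Prop :=
  [/\ measurable_fun setT h, forall x, (0 <= h x <= 1)%E,
      forall x x', (h x <= h x' + (r * N (x - x'))%:E)%E &
      (\int[lebesgue_cv R p]_x ((post x)%:E * h x) = a)%E].

(** The induction starts at one step: for zero steps the iterate is an indicator, and one
    application of the kernel makes it Lipschitz through the total variation bound. Each further
    step multiplies the constant by [rho]. *)
Lemma iter_acda_kernel_lip (A : set 'cV[R]_p) m : measurable A ->
  lipschitz_mean (rho ^+ m.+1) (posterior X y Q v A)
    (fun x => iter_kernel K m.+1 x A).
Proof.
move=> mA.
have m1 : measurable_fun setT (fun x : 'cV[R]_p => (\1_A x)%:E : \bar R).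
  by apply/measurable_EFinP; exact: measurable_indic.
have i0 x : (0 <= (\1_A x)%:E :> \bar R)%E by rewrite lee_fin.
have le1 f : measurable_fun setT f -> (forall x, 0 <= f x <= 1)%E ->
    forall x, (0 <= da_step X y Q v f x <= 1)%E.
  move=> mf f01 x; have f0 t : (0 <= f t)%E by case/andP: (f01 t).
  rewrite da_step_ge0//= -(da_step1 X y v dQ x); apply: da_step_le => //.
  by move=> t; case/andP: (f01 t).
elim: m => [|m].
  have -> : (fun x => iter_kernel K 1 x A) = da_step X y Q v (fun x => (\1_A x)%:E).
    by apply/funext => x; exact: acda_kernel_indic.
  split.
  - exact: measurable_da_step.
  - by apply: le1 => [//|x]; rewrite i0/= lee_fin indicE; case: (x \in A); rewrite ?lexx ?ler01.
  - by move=> x x'; rewrite expr1; exact: da_step_indic_lip.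
  - by rewrite posterior_invariant// posteriorE.
set h' := fun x => iter_kernel K m.+1 x A.
move=> [mh' h'01 lh' ih'].
have h'0 x : (0 <= h' x)%E by case/andP: (h'01 x).
have -> : (fun x => iter_kernel K m.+2 x A) = da_step X y Q v h'.
  by apply/funext => x; exact: integral_acda_kernel.
split.
- exact: measurable_da_step.
- exact: le1.
- move=> x x'; rewrite exprS; apply: da_step_lip => //.
  exact: exprn_ge0.
- by rewrite posterior_invariant.
Qed.

Definition ergodicity_cst (beta : 'cV[R]_p) : R :=
  fine (\int[lebesgue_cv R p]_x ((post x)%:E * (N (beta - x))%:E))%E.

Lemma ergodicity_cstE beta : (ergodicity_cst beta)%:E =
  (\int[lebesgue_cv R p]_x ((post x)%:E * (N (beta - x))%:E))%E.
Proof.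
rewrite fineK// ge0_fin_numE; first exact: posterior_moment_lty.
apply: integral_ge0 => x _; apply: mule_ge0; first exact: posterior_pdf_ge0.
by rewrite lee_fin; exact: post_norm_ge0.
Qed.

Lemma ergodicity_cst_ge0 beta : 0 <= ergodicity_cst beta.
Proof.
apply: fine_ge0; apply: integral_ge0 => x _; apply: mule_ge0.
  exact: posterior_pdf_ge0.
by rewrite lee_fin; exact: post_norm_ge0.
Qed.

Lemma iter_acda_kernel_tv beta m (A : set 'cV[R]_p) : measurable A ->
  (`|iter_kernel K m.+1 beta A - posterior X y Q v A| <=
   (ergodicity_cst beta * rho ^+ m.+1)%:E)%E.
Proof.
move=> /(iter_acda_kernel_lip m).
rewrite -[iter_kernel _ _ _ _]/((fun x => iter_kernel K m.+1 x A) beta).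
move: (fun x => iter_kernel K m.+1 x A) => h [mh h01 lh ih].
have h0 x : (0 <= h x)%E by case/andP: (h01 x).
have r0 : 0 <= rho ^+ m.+1 by exact: exprn_ge0.
have mc : measurable_fun setT (cst (h beta) : 'cV[R]_p -> \bar R) by exact: measurable_cst.
have ic : (\int[lebesgue_cv R p]_x ((post x)%:E * cst (h beta) x) = h beta)%E.
  rewrite ge0_integralZr//.
  - by rewrite integral_posterior_pdf// mul1e.
  - exact: measurable_posterior_pdf.
  - by move=> x _; exact: posterior_pdf_ge0.
(* The constant [h beta] is its own posterior average, so the two averaged inequalities bound the
   difference from above and from below; [eq_ind] only exchanges the two points in the norm. *)
have := posterior_average_le y v dQ r0 mh h0 mc (fun=> h0 beta)
  (fun x => eq_ind _ (fun t => (h x <= h beta + (_ * t)%:E)%E) (lh x beta) _ (post_normC X Q x beta)).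
have := posterior_average_le y v dQ r0 mc (fun=> h0 beta) mh h0 (lh beta).
rewrite ic ih -ergodicity_cstE -EFinM.
have hf : h beta \is a fin_num.
  by rewrite ge0_fin_numE//; case/andP: (h01 beta) => _ /le_lt_trans; apply; exact: ltry.
rewrite -(fineK hf); set a := fine _.
have P0 : (0 <= posterior X y Q v A)%E.
  by apply: integral_ge0 => x _; exact: posterior_pdf_ge0.
case: (posterior X y Q v A) P0 => [b| |]// _.
- rewrite -!EFinD !lee_fin /= ler_norml => h1 h2.
  by apply/andP; split; lra.
Qed.

End geometric_ergodicity.

Theorem mainTheorem2 (R : realType) (n p : nat) (hn : (1 <= n)%N)
  (hp : (1 <= p)%N) (X : 'M[R]_(n, p)) (y : 'I_n -> bool)
  (Q : 'M[R]_p) (hQ : sym_posdef Q) (v : 'cV[R]_p) :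
  exists (eta : R) (C : 'cV[R]_p -> R),
    [/\ 0 <= eta, eta < 1, forall beta, 0 <= C beta &
      forall (beta : 'cV[R]_p) (m : nat), (1 <= m)%N ->
        (ereal_sup [set `|iter_kernel (acda_kernel X y Q v) m beta A
                         - posterior X y Q v A|
                   | A in (measurable : set (set 'cV[R]_p))]
         <= (C beta * eta ^+ m)%:E)%E].
Proof.
have [rho [rho0 rho1 rhoX]] := gram_contraction X hQ.
exists rho, (ergodicity_cst X y Q v); split=> //.
- by move=> beta; exact: ergodicity_cst_ge0.
- move=> beta [//|m] _; apply: ge_ereal_sup => _ [A mA <-].
  exact: iter_acda_kernel_tv.
Qed.
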